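(* Let $0<p<p_c$. Then for every $A\in S$, the distribution of $\zeta^A_n$ converges weakly, as $n\to\infty$, to $\nu$, where $\nu$ is the probability measure on $S_0$ described in the context (the limit of the conditional distribution of $\zeta^{\{0\}}_n$ given $\{T>n\}$).
   Context: Let $\Lambda=\{(x,y)\in\mathbb{Z}^2: y\geq 0,\ x+y\in 2\mathbb{Z}\}$. From each $(m,n)\in\Lambda$ draw oriented bonds to $(m+1,n+1)$ and to $(m-1,n+1)$. Bonds are open independently, each with probability $p\in(0,1)$ (two-dimensional oriented bond percolation). For $A\subseteq 2\mathbb{Z}$ let $\xi^A_n=\{y: (y,n)\in\Lambda \text{ and there is an open oriented path from } (x,0) \text{ to } (y,n) \text{ for some } x\in A\}$, $n\ge 0$. Let $p_c=\sup\{p: P(\xi^{\{0\}}_n\neq\varnothing \text{ for all } n)=0\}$; it is known that $0<p_c<1$. For $A$ an infinite subset of $2\mathbb{Z}$ bounded above, $\xi^A_n$ is a.s. infinite and bounded above; put $r(\xi^A_n)=\sup \xi^A_n$ and $\zeta^A_n=\{x-r(\xi^A_n): x\in\xi^A_n\}$. For finite nonempty $A$ define $\zeta^A_n$ the same way when $\xi^A_n\neq\varnothing$ and $\zeta^A_n=\varnothing$ when $\xi^A_n=\varnothing$. Let $2\mathbb{Z}_-=\{0,-2,-4,\dots\}$, $S=\{$infinite subsets of $2\mathbb{Z}_-$ containing $0\}$, $S_0=\{$finite subsets of $2\mathbb{Z}_-$ containing $0\}$, $\bar S=\{$subsets of $2\mathbb{Z}_-\}$, identified with $\{0,1\}^{2\mathbb{Z}_-}$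 via indicator functions and given the product topology; measures on $S$ or $S_0$ are regarded as measures on $\bar S$, and convergence of distributions is weak convergence on $\bar S$. Let $T=\inf\{n:\zeta^{\{0\}}_n=\varnothing\}$. It is known that for $0<p<p_c$ the conditional distribution of $\zeta^{\{0\}}_n$ given $\{T>n\}$ converges as $n\to\infty$ to a probability measure $\nu$ on $S_0$ (the minimal quasi-stationary distribution of the process $\zeta$ on $S_0\cup\{\varnothing\}$). *)

(* Defs.v *)
From HB Require Import structures.
From mathcomp Require Import all_boot all_order all_algebra.
From mathcomp Require Import all_classical all_reals all_analysis.
Set Implicit Arguments. Unset Strict Implicit. Unset Printing Implicit Defensive.
Import Order.TTheory GRing.Theory Num.Theory.
Import numFieldNormedType.Exports.
Local Open Scope classical_set_scope.
Local Open Scope ring_scope.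

(* A bond is indexed by (m, n, b): it starts at the site (m, n) and goes to
   (m+1, n+1) if b = true, to (m-1, n+1) if b = false.  A bond configuration
   is a family  X : int * nat * bool -> Omega -> bool  (X i w = true iff
   bond i is open in the outcome w).  Only bonds starting at sites of Lambda
   (m + n even) are ever used by the process below. *)
Definition bond := (int * nat * bool)%type.

(* X is a family of i.i.d. Bernoulli(p) bond variables under P:
   every event {bond i open} is measurable and, for any finite family of
   distinct bonds, the probability that they are all open is p^(size). *)
Definition bond_model {d} {Omega : measurableType d} {R : realType}
  (P : probability Omega R) (X : bond -> Omega -> bool) (p : R) : Prop :=
  (forall i, measurable [set w | X i w]) /\
  (forall s : seq bond, uniq s ->
     P (\big[setI/setT]_(i <- s) [set w | X i w]) = ((p ^+ size s)%:E)%E).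

Fixpoint xi {Omega : Type} (X : bond -> Omega -> bool) (A : set int)
  (n : nat) (w : Omega) : set int :=
  match n with
  | 0 => A
  | n'.+1 => [set y | exists x, xi X A n' w x /\
        ((y = x + 1 /\ X (x, n', true) w) \/ (y = x - 1 /\ X (x, n', false) w))]
  end.

(* zeta^A_n : xi^A_n shifted so that its maximum r(xi^A_n) sits at 0;
   empty when xi^A_n has no maximum (in particular when xi^A_n is empty;
   for A bounded above xi^A_n is bounded above, so nonempty implies a max). *)
Definition zeta {Omega : Type} (X : bond -> Omega -> bool) (A : set int)
  (n : nat) (w : Omega) : set int :=
  [set z | exists r, xi X A n w r /\ (forall y, xi X A n w y -> y <= r)
                     /\ xi X A n w (z + r)].

(* Identification of subsets of 2Z_- = {0,-2,-4,...} with {0,1}^{2Z_-}: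
   coordinate k : nat corresponds to the site -2k. *)
Definition zeta_ind {Omega : Type} (X : bond -> Omega -> bool) (A : set int)
  (n : nat) (w : Omega) : cantor_space :=
  fun k : nat => `[< zeta X A n w (- (2 * (k : int))) >].

Definition alive {Omega : Type} (X : bond -> Omega -> bool) (n : nat) : set Omega :=
  [set w | xi X [set 0] n w !=set0].

Definition survive {Omega : Type} (X : bond -> Omega -> bool) : set Omega :=
  [set w | forall n, xi X [set 0] n w !=set0].

Definition theta_zero (R : realType) (q : R) : Prop :=
  forall (d : measure_display) (Omega : measurableType d)
         (Q : probability Omega R) (X : bond -> Omega -> bool),
    bond_model Q X q -> Q (survive X) = 0%E.

Definition p_c (R : realType) : R := sup [set q : R | 0 < q < 1 /\ theta_zero q].

Definition in_S (A : set int) : Prop :=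
  A `<=` [set x : int | x <= 0 /\ ~~ odd `|x|%N] /\ A 0 /\ ~ finite_set A.

Definition expect_f {d} {Omega : measurableType d} {R : realType}
  (P : probability Omega R) (X : bond -> Omega -> bool) (A : set int)
  (f : cantor_space -> R) (n : nat) : R :=
  fine (\int[P]_w (f (zeta_ind X A n w))%:E)%E.

Definition cond_expect_f {d} {Omega : measurableType d} {R : realType}
  (P : probability Omega R) (X : bond -> Omega -> bool)
  (f : cantor_space -> R) (n : nat) : R :=
  fine (\int[P]_(w in alive X n) (f (zeta_ind X [set 0] n w))%:E)%E
  / fine (P (alive X n)).

(* Main.v *)
Require Import Defs.
From HB Require Import structures.
From mathcomp Require Import all_boot all_order all_algebra.
From mathcomp Require Import all_classical all_reals all_analysis.
From mathcomp Require Import measurable_realfun.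
From mathcomp Require Import zify ring lra.
Set Implicit Arguments. Unset Strict Implicit. Unset Printing Implicit Defensive.
Import Order.TTheory GRing.Theory Num.Theory.
Import numFieldNormedType.Exports.
Local Open Scope classical_set_scope.
Local Open Scope ring_scope.

(* Let g be the rightmost open path from A to level n.  Given g, the bonds on its left are
   unconditioned, so what zeta^A_n looks like near 0 is decided by the last steps of g, up to the
   event that a dual cluster on the left of g survives for a long time.  Given g, the bonds on its
   right are conditioned by a decreasing event, so by Harris' inequality the clusters on the right of
   g are dominated by unconditioned subcritical ones.  Hence, in a time window far before n but of
   bounded distance to n, there is with high probability a time t at which no other point
   within distance 2(n - t) to the right of g is occupied.  At the first such time the future of g is
   independent of the past, and it has exactly the law of the process started from one point and
   conditioned to survive n - t more steps.  The only input is that the survival probability up to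
   level n decays fast; this is deduced from p < p_c by the argument of Duminil-Copin and Tassion,
   for which a bond model with a parameter q > p is realised on [0, 1] through the digits of nested
   subintervals. *)

(** * Finite-volume expectations *)

(** A cut time has to be local. Among infinitely many starting points the rightmost one that reaches
    level n usually lies far to the left, and some of the clusters to its right may well be alive at
    time t, so a time with nothing at all to the right of g cannot be counted on. The width 2(n - t)
    comes from two light cones: in n - t steps each of two paths moves by at most n - t, so the
    paths beyond the gap never use a bond of the cone of (g t, t), and the requirement that they die
    before level n belongs to the information outside this cone. An infinite start is out of reach
    of finite sums over configurations, so A is cut off at -N. The estimates for finite starts are
    uniform in the start, which enters only through the probability that no path from it reaches
    level n; for fixed n this probability is small once N is large, because A is infinite. *)

Definition config := bond -> bool.

Definition upd (w : config) (e : bond) (b : bool) : config :=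
  fun e' => if e' == e then b else w e'.

Definition ind {R : realType} (Q : Prop) : R := (`[< Q >])%:R.

Definition dep {T : Type} (D : set bond) (F : config -> T) : Prop :=
  forall w w' : config, (forall e, D e -> w e = w' e) -> F w = F w'.

Definition incr (Q : config -> Prop) : Prop :=
  forall w w' : config, (forall e, w e -> w' e) -> Q w -> Q w'.

Definition nondecr {R : realType} (F : config -> R) : Prop :=
  forall w w' : config, (forall e, w e -> w' e) -> F w <= F w'.

(* Expectation for percolation on the bonds of [s], all other bonds closed *)
Fixpoint esp {R : realType} (p : R) (s : seq bond) (F : config -> R) : R :=
  if s is e :: s' then
    p * esp p s' (fun w => F (upd w e true)) +
    (1 - p) * esp p s' (fun w => F (upd w e false))
  else F (fun=> false).

Definition prob {R : realType} (p : R) (s : seq bond) (Q : config -> Prop) : R :=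
  esp p s (fun w => ind (Q w)).

Section indicator.
Context {R : realType}.
Implicit Types P Q : Prop.

Lemma ind_true Q : Q -> ind Q = 1 :> R.
Proof. by move=> h; rewrite /ind asboolT. Qed.

Lemma ind_false Q : ~ Q -> ind Q = 0 :> R.
Proof. by move=> h; rewrite /ind asboolF. Qed.

Lemma ind_ge0 Q : 0 <= ind Q :> R.
Proof. exact: ler0n. Qed.

Lemma ind_le1 Q : ind Q <= 1 :> R.
Proof. by rewrite /ind; case: `[< _ >]. Qed.

Lemma ind_le P Q : (P -> Q) -> ind P <= ind Q :> R.
Proof.
move=> h; case: (pselect P) => hP; first by rewrite !ind_true //; exact: h.
by rewrite (ind_false hP) ind_ge0.
Qed.

Lemma ind_eq P Q : (P <-> Q) -> ind P = ind Q :> R.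
Proof. by move=> h; rewrite (propext h). Qed.

Lemma ind_and P Q : ind (P /\ Q) = ind P * ind Q :> R.
Proof. by rewrite /ind asbool_and -natrM mulnb. Qed.

Lemma ind_or_le P Q : ind (P \/ Q) <= ind P + ind Q :> R.
Proof.
case: (pselect P) => hP; first by rewrite (ind_true (or_introl hP)) (ind_true hP) lerDl ind_ge0.
case: (pselect Q) => hQ; first by rewrite (ind_true (or_intror hQ)) (ind_true hQ) lerDr ind_ge0.
by rewrite ind_false ?addr_ge0 ?ind_ge0 // => -[].
Qed.

Lemma ind_not Q : ind (~ Q) = 1 - ind Q :> R.
Proof.
by case: (pselect Q) => hQ; [rewrite ind_false ?ind_true ?subrr|rewrite ind_true ?ind_false ?subr0].
Qed.

End indicator.

Lemma upd_same w e b : upd w e b e = b. Proof. by rewrite /upd eqxx. Qed.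

Lemma upd_other w e b e' : e' != e -> upd w e b e' = w e'.
Proof. by rewrite /upd => /negbTE ->. Qed.

Lemma updC w e e' b b' : e != e' -> upd (upd w e b) e' b' = upd (upd w e' b') e b.
Proof.
move=> ne; apply: funext => x; rewrite /upd.
by case: (eqVneq x e) => // ->; rewrite (negbTE ne).
Qed.

Lemma upd_le (w w' : config) e b : (forall x, w x -> w' x) -> forall x, upd w e b x -> upd w' e b x.
Proof. by move=> h x; rewrite /upd; case: ifP => // _; exact: h. Qed.

Section esp_theory.
Context {R : realType} (p : R) (p0 : 0 <= p) (p1 : p <= 1).
Implicit Types (s : seq bond) (F G : config -> R) (D : set bond).

Lemma esp_ext s F G : F =1 G -> esp p s F = esp p s G.
Proof. by move=> /funext ->. Qed.

Lemma espD s F G : esp p s (fun w => F w + G w) = esp p s F + esp p s G.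
Proof. by elim: s F G => //= e s IH F G; rewrite !IH; ring. Qed.

Lemma espZ s c F : esp p s (fun w => c * F w) = c * esp p s F.
Proof. by elim: s F => //= e s IH F; rewrite !IH; ring. Qed.

Lemma espN s F : esp p s (fun w => - F w) = - esp p s F.
Proof. by elim: s F => //= e s IH F; rewrite !IH; ring. Qed.

Lemma espB s F G : esp p s (fun w => F w - G w) = esp p s F - esp p s G.
Proof. by rewrite espD espN. Qed.

Lemma esp_cst s c : esp p s (fun=> c) = c.
Proof. by elim: s => //= e s IH; rewrite !IH; ring. Qed.

Lemma esp_sum (I : Type) (r : seq I) (P : pred I) s (F : I -> config -> R) :
  esp p s (fun w => \sum_(i <- r | P i) F i w) = \sum_(i <- r | P i) esp p s (F i).
Proof.
elim: r => [|i r IH].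
  by rewrite big_nil -[RHS](esp_cst s 0); apply: esp_ext => w; rewrite big_nil.
rewrite big_cons -IH; case: ifPn => Pi; last first.
  by apply: esp_ext => w; rewrite big_cons (negbTE Pi).
by rewrite -espD; apply: esp_ext => w; rewrite big_cons Pi.
Qed.

Lemma esp_le s F G : (forall w, F w <= G w) -> esp p s F <= esp p s G.
Proof.
elim: s F G => [|e s IH] F G h /=; first exact: h.
by apply: lerD; apply: ler_wpM2l; rewrite ?subr_ge0 //; apply: IH => w; exact: h.
Qed.

Lemma esp_ge0 s F : (forall w, 0 <= F w) -> 0 <= esp p s F.
Proof. by move=> h; rewrite -(esp_cst s 0); exact: esp_le. Qed.

Lemma dep_upd (T : Type) D (F : config -> T) e b : dep D F -> dep D (fun w => F (upd w e b)).
Proof. by move=> h w w' ww'; apply: h => x Dx; rewrite /upd; case: ifP => // _; exact: ww'. Qed.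

Lemma dep_upd_id (T : Type) D (F : config -> T) e b w : dep D F -> ~ D e -> F (upd w e b) = F w.
Proof. by move=> h De; apply: h => x Dx; rewrite upd_other //; apply/eqP => xe; rewrite xe in Dx. Qed.

(** Induction on the bonds: each bond is outside [D1] or outside [D2], so one of the two factors
    ignores it and comes out of the average over its state. *)
Lemma esp_indep s D1 D2 F G : dep D1 F -> dep D2 G -> (forall e, D1 e -> D2 e -> False) ->
  esp p s (fun w => F w * G w) = esp p s F * esp p s G.
Proof.
move=> + + D12; elim: s F G => [|e s IH] //= F G hF hG.
rewrite !IH; try by apply: dep_upd.
case: (pselect (D1 e)) => De.
  have nD2 : ~ D2 e by move=> h; exact: D12 De h.
  by rewrite !(esp_ext _ (fun w => dep_upd_id _ w hG nD2)); ring.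
by rewrite !(esp_ext _ (fun w => dep_upd_id _ w hF De)); ring.
Qed.

Lemma nondecr_upd F e b : nondecr F -> nondecr (fun w => F (upd w e b)).
Proof. by move=> h w w' ww'; apply: h; exact: upd_le. Qed.

Lemma nondecr_updFT F e w : nondecr F -> F (upd w e false) <= F (upd w e true).
Proof. by move=> h; apply: h => x; rewrite /upd; case: ifP. Qed.

(** Induction on the bonds. Averaging over one more bond adds the covariance p(1 - p)(a1 - a0)(b1 -
    b0) of the two partial means, and both differences are nonnegative. *)
Lemma esp_harris s F G : nondecr F -> nondecr G ->
  esp p s F * esp p s G <= esp p s (fun w => F w * G w).
Proof.
elim: s F G => [|e s IH] //= F G hF hG.
have H b := IH _ _ (nondecr_upd e b hF) (nondecr_upd e b hG).
have hp : 0 <= 1 - p by rewrite subr_ge0.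
apply: le_trans (lerD (ler_wpM2l p0 (H true)) (ler_wpM2l hp (H false))).
set a1 := esp _ _ _; set a0 := esp _ _ _; set b1 := esp _ _ (fun w => G _); set b0 := esp _ _ (fun w => G _).
have : 0 <= p * (1 - p) * ((a1 - a0) * (b1 - b0)).
  by rewrite !mulr_ge0 // subr_ge0; apply: esp_le => w; exact: nondecr_updFT.
move=> h; rewrite -subr_ge0; apply: le_trans h _.
by rewrite le_eqVlt; apply/orP; left; apply/eqP; ring.
Qed.

(** The support of [esp]. It is finite, so any map of the configuration takes finitely many values
    on it, and every bond off [s] is closed there. *)
Fixpoint configs s : seq config :=
  if s is e :: s' then [seq upd w e true | w <- configs s'] ++ [seq upd w e false | w <- configs s']
  else [:: fun=> false].

Lemma esp_ext_in s F G : {in configs s, F =1 G} -> esp p s F = esp p s G.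
Proof.
elim: s F G => [|e s IH] F G h /=; first by apply: h; rewrite inE.
by congr (_ * _ + _ * _); apply: IH => w hw; apply: h; rewrite /= mem_cat; apply/orP;
  [left|right]; apply/mapP; exists w.
Qed.

Lemma configs_closed s w e : w \in configs s -> e \notin s -> w e = false.
Proof.
elim: s w => [|e' s IH] w /=; first by rewrite inE => /eqP ->.
rewrite mem_cat inE negb_or => /orP[] /mapP[w' hw' ->] /andP[ne nes];
  by rewrite upd_other //; exact: IH.
Qed.

(* Conditioning on v, whose finitely many values never have to be named *)
Lemma esp_cond_le (V : eqType) (v : config -> V) s F G :
  (forall x, esp p s (fun w => ind (v w = x) * F w) <= esp p s (fun w => ind (v w = x) * G w)) ->
  esp p s F <= esp p s G.
Proof.
move=> h.
have tot H : esp p s H =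
    \sum_(x <- undup [seq v w | w <- configs s]) esp p s (fun w => ind (v w = x) * H w).
  rewrite -esp_sum; apply: esp_ext_in => w hw.
  rewrite (bigD1_seq (v w)) ?undup_uniq ?mem_undup ?map_f //= ind_true // mul1r.
  by rewrite big1 ?addr0 // => x hx; rewrite ind_false ?mul0r // => xw; rewrite xw eqxx in hx.
by rewrite !tot; apply: ler_sum => x _; exact: h.
Qed.

Lemma esp_swap s e e' F : esp p (e :: e' :: s) F = esp p (e' :: e :: s) F.
Proof.
case: (eqVneq e e') => [->//|ne] /=.
have H b b' : esp p s (fun w => F (upd (upd w e' b') e b)) = esp p s (fun w => F (upd (upd w e b) e' b')).
  by apply: esp_ext => w; rewrite updC // eq_sym.
by rewrite !H; ring.
Qed.

Lemma esp_mid s1 s2 e F : esp p (s1 ++ e :: s2) F = esp p (e :: s1 ++ s2) F.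
Proof.
elim: s1 F => // e' s1 IH F.
rewrite -[(e' :: s1) ++ s2]/(e' :: (s1 ++ s2)) esp_swap.
by rewrite -[(e' :: s1) ++ _]/(e' :: (s1 ++ e :: s2)) [LHS]/= !IH.
Qed.

Lemma esp_perm s s' F : perm_eq s s' -> esp p s F = esp p s' F.
Proof.
elim: s s' F => [|e s IH] s' F h.
  by move: (perm_size h) => /esym /size0nil ->.
have : e \in s' by rewrite -(perm_mem h) mem_head.
move=> /splitPr hs; case: hs h => s1 s2 h; rewrite esp_mid /=.
have hs : perm_eq s (s1 ++ s2).
  by rewrite -(perm_cons e) (perm_trans h) // -[e :: s2]cat1s perm_catCA.
by rewrite !(IH _ _ hs).
Qed.

Lemma esp_filter s (D : pred bond) F : dep [set e | D e] F -> esp p s F = esp p [seq e <- s | D e] F.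
Proof.
elim: s F => //= e s IH F h; case: ifPn => /= De; rewrite !(IH _ (dep_upd _ _ h)) //.
have nD : ~ [set e | D e] e by exact/negP.
by rewrite !(esp_ext _ (fun w => dep_upd_id _ w h nD)); ring.
Qed.

(** The tool for comparing expectations over different boxes: the lists have to agree only on the
    bonds that [F] can see. *)
Lemma esp_irrel s s' (D : pred bond) F : dep [set e | D e] F -> uniq s -> uniq s' ->
  (forall e, D e -> (e \in s) = (e \in s')) -> esp p s F = esp p s' F.
Proof.
move=> h us us' ss'; rewrite (esp_filter s h) (esp_filter s' h); apply: esp_perm.
apply: uniq_perm; rewrite ?filter_uniq // => e; rewrite !mem_filter.
by case: (boolP (D e)) => //= /ss'.
Qed.

Lemma esp_relabel s (f : bond -> bond) F : injective f ->
  esp p [seq f e | e <- s] (fun w => F (w \o f)) = esp p s F.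
Proof.
move=> fi; elim: s F => //= e s IH F; rewrite -!IH.
have H w b : (upd w (f e) b) \o f = upd (w \o f) e b.
  by apply: funext => x; rewrite /upd /= (inj_eq fi).
by congr (_ * _ + _ * _); apply: esp_ext => w; rewrite H.
Qed.

Lemma esp_single e F s : e \in s -> uniq s -> dep [set e] F ->
  esp p s F = p * F (fun=> true) + (1 - p) * F (fun=> false).
Proof.
move=> es us h; have h' : dep [set x | pred1 e x] F.
  by move=> w w' ww'; apply: h => x ->; apply: ww' => /=.
rewrite (esp_filter s h') filter_pred1_uniq //=.
by congr (_ * _ + _ * _); apply: h => x ->; rewrite upd_same.
Qed.

Lemma prob_ge0 s Q : 0 <= prob p s Q.
Proof. by apply: esp_ge0 => w; exact: ind_ge0. Qed.

Lemma prob_le1 s Q : prob p s Q <= 1.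
Proof. by rewrite -[leRHS](esp_cst s 1); apply: esp_le => w; exact: ind_le1. Qed.

Lemma prob_le s (Q Q' : config -> Prop) : (forall w, Q w -> Q' w) -> prob p s Q <= prob p s Q'.
Proof. by move=> h; apply: esp_le => w; exact/ind_le/h. Qed.

Lemma prob_eq s (Q Q' : config -> Prop) : (forall w, Q w <-> Q' w) -> prob p s Q = prob p s Q'.
Proof. by move=> h; apply: esp_ext => w; exact: ind_eq. Qed.

Lemma prob_or s (Q Q' : config -> Prop) : prob p s (fun w => Q w \/ Q' w) <= prob p s Q + prob p s Q'.
Proof. by rewrite -espD; apply: esp_le => w; exact: ind_or_le. Qed.

Lemma prob_not s (Q : config -> Prop) : prob p s (fun w => ~ Q w) = 1 - prob p s Q.
Proof.
by rewrite -[X in X - _](esp_cst s 1) -espB; apply: esp_ext => w; exact: ind_not.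
Qed.

Lemma prob_exists (I : eqType) (r : seq I) s (Q : I -> config -> Prop) :
  prob p s (fun w => exists2 i, i \in r & Q i w) <= \sum_(i <- r) prob p s (Q i).
Proof.
elim: r => [|i r IH].
  by rewrite big_nil -[leRHS](esp_cst s 0); apply: esp_le => w; rewrite ind_false // => -[].
rewrite big_cons; apply: le_trans (lerD (lexx _) IH); apply: le_trans (prob_or _ _ _).
apply: prob_le => w [j]; rewrite inE => /orP[/eqP ->|jr] h; first by left.
by right; exists j.
Qed.

Lemma dep_ind D (Q : config -> Prop) : dep D Q -> dep D (fun w => ind (Q w) : R).
Proof. by move=> h w w' /h ->. Qed.

Lemma dep_prop D (Q : config -> Prop) :
  (forall w w', (forall e, D e -> w e = w' e) -> Q w -> Q w') -> dep D Q.
Proof.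
by move=> h w w' ww'; apply: propext; split; apply: h => // e De; rewrite ww'.
Qed.

Lemma dep_sub (T : Type) D D' (F : config -> T) : D `<=` D' -> dep D F -> dep D' F.
Proof. by move=> DD h w w' ww'; apply: h => e /DD; exact: ww'. Qed.

Lemma dep_not D (Q : config -> Prop) : dep D Q -> dep D (fun w => ~ Q w).
Proof. by move=> h w w' /h ->. Qed.

Lemma dep_and D (Q Q' : config -> Prop) : dep D Q -> dep D Q' -> dep D (fun w => Q w /\ Q' w).
Proof. by move=> h h' w w' ww'; rewrite (h _ _ ww') (h' _ _ ww'). Qed.

Lemma prob_indep s D1 D2 (Q Q' : config -> Prop) : dep D1 Q -> dep D2 Q' ->
  (forall e, D1 e -> D2 e -> False) ->
  prob p s (fun w => Q w /\ Q' w) = prob p s Q * prob p s Q'.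
Proof.
move=> h h' D12; rewrite -(esp_indep s (dep_ind h) (dep_ind h') D12).
by apply: esp_ext => w; exact: ind_and.
Qed.

Lemma incr_nondecr (Q : config -> Prop) : incr Q -> nondecr (fun w => ind (Q w) : R).
Proof. by move=> h w w' ww'; apply: ind_le; exact: h. Qed.

Lemma prob_harris_decr s (Q Q' : config -> Prop) : incr Q -> incr Q' ->
  prob p s (fun w => ~ Q w) * prob p s (fun w => ~ Q' w) <= prob p s (fun w => ~ Q w /\ ~ Q' w).
Proof.
move=> h h'; rewrite !prob_not.
have -> : prob p s (fun w => ~ Q w /\ ~ Q' w) =
    1 - prob p s Q - prob p s Q' + esp p s (fun w => ind (Q w) * ind (Q' w)).
  rewrite -[X in X - _ - _](esp_cst s 1) -!espB -espD; apply: esp_ext => w.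
  by rewrite ind_and !ind_not; ring.
have := esp_harris s (incr_nondecr h) (incr_nondecr h').
by rewrite -!/(prob _ _ _); lra.
Qed.

Lemma prob_harris_mix s (Q Q' : config -> Prop) : incr Q -> incr Q' ->
  prob p s (fun w => ~ Q w /\ Q' w) <= prob p s (fun w => ~ Q w) * prob p s Q'.
Proof.
move=> h h'; rewrite prob_not.
have -> : prob p s (fun w => ~ Q w /\ Q' w) =
    prob p s Q' - esp p s (fun w => ind (Q w) * ind (Q' w)).
  by rewrite -espB; apply: esp_ext => w; rewrite ind_and !ind_not; ring.
have := esp_harris s (incr_nondecr h) (incr_nondecr h').
by rewrite -!/(prob _ _ _); lra.
Qed.

(** Bonds off the list are closed, so a longer list can only open more bonds, which favours an
    increasing event. *)
Lemma prob_superset s s' (Q : config -> Prop) : uniq s -> uniq s' -> {subset s <= s'} ->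
  incr Q -> prob p s Q <= prob p s' Q.
Proof.
move=> us us' ss' hQ; rewrite /prob.
have -> : esp p s' (fun w => ind (Q w)) = esp p ([seq e <- s' | e \notin s] ++ s) (fun w => ind (Q w)).
  apply: esp_perm; apply: uniq_perm => //.
    rewrite cat_uniq filter_uniq // us andbT /=; apply/hasPn => e es; rewrite mem_filter.
    by rewrite es.
  move=> e; rewrite mem_cat mem_filter.
  by case: (boolP (e \in s)) => [/ss' -> //|_]; rewrite orbF.
have : all (fun e => e \notin s) [seq e <- s' | e \notin s] by exact: filter_all.
elim: [seq e <- s' | e \notin s] (fun w => ind (Q w) : R) (incr_nondecr hQ) => // e r IH F hF.
move=> /= /andP[es hr].
have H b := IH _ (nondecr_upd e b hF) hr.
have hp : 0 <= 1 - p by rewrite subr_ge0.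
apply: le_trans (lerD (ler_wpM2l p0 (H true)) (ler_wpM2l hp (H false))).
have -> : esp p s F = esp p s (fun w => F (upd w e false)).
  apply: esp_ext_in => w hw; congr F; apply: funext => x; rewrite /upd.
  by case: eqP => // ->; exact: configs_closed hw es.
have : esp p s (fun w => F (upd w e false)) <= esp p s (fun w => F (upd w e true)).
  by apply: esp_le => w; exact: nondecr_updFT.
by move: p0; nra.
Qed.

End esp_theory.

(** * Open paths *)

Definition step (w : config) (x : int) (t : nat) (y : int) : Prop :=
  (y = x + 1 /\ w (x, t, true)) \/ (y = x - 1 /\ w (x, t, false)).

Definition opath (w : config) (q : nat -> int) (a b : nat) : Prop :=
  forall u, (a <= u < b)%N -> step w (q u) u (q u.+1).

Definition join_at (c : nat) (q q' : nat -> int) : nat -> int :=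
  fun u => if (u <= c)%N then q u else q' u.

Definition pmax (q q' : nat -> int) : nat -> int :=
  fun u => if q u <= q' u then q' u else q u.

Definition evenz (x : int) : Prop := exists k : int, x = 2 * k.

(** The canonical bond variables on configurations; through them [xi], [alive] and [zeta_ind] become
    functions of a configuration, to which [esp] applies. *)
Definition cfg_coord : bond -> config -> bool := fun e w => w e.

Definition shift_bond (y : int) (t : nat) (e : bond) : bond :=
  (e.1.1 + y, (e.1.2 + t)%N, e.2).

(** The configuration as seen from the site (y, t). *)
Definition translate (y : int) (t : nat) (w : config) : config := w \o shift_bond y t.

Lemma step_diff w x t y : step w x t y -> y = x + 1 \/ y = x - 1.
Proof. by case=> -[]; [left|right]. Qed.

Lemma step_bound w x t y : step w x t y -> x - 1 <= y <= x + 1.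
Proof. by case=> -[->]; lia. Qed.

Lemma opath_sub w q a b a' b' : (a <= a')%N -> (b' <= b)%N -> opath w q a b -> opath w q a' b'.
Proof. by move=> aa bb h u ub; apply: h; lia. Qed.

Lemma opath_ext w q q' a b : (forall u, (a <= u <= b)%N -> q u = q' u) -> opath w q a b -> opath w q' a b.
Proof. by move=> h o u ub; rewrite -!h; [exact: o|lia|lia]. Qed.

Lemma opath_cat w q a b c : opath w q a b -> opath w q b c -> opath w q a c.
Proof. by move=> h h' u ub; case: (ltnP u b) => hu; [apply: h|apply: h']; lia. Qed.

Lemma opath_join w q q' a b c : q b = q' b -> opath w q a b -> opath w q' b c ->
  (a <= b)%N -> opath w (join_at b q q') a c.
Proof.
move=> e h h' ab; apply: (@opath_cat _ _ _ b).
  by apply: opath_ext h => u ub; rewrite /join_at; case: ifP => //; lia.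
apply: opath_ext h' => u ub; rewrite /join_at; case: ifP => // ub'.
by have -> : u = b by lia.
Qed.

Lemma join_atL c q q' u : (u <= c)%N -> join_at c q q' u = q u.
Proof. by rewrite /join_at => ->. Qed.

Lemma join_atR c q q' u : q c = q' c -> (c <= u)%N -> join_at c q q' u = q' u.
Proof.
move=> e; rewrite /join_at leq_eqVlt => /orP[/eqP <-|]; first by rewrite leqnn.
by rewrite ltnNge => /negbTE ->.
Qed.

Lemma opath_drift w q a b u v : opath w q a b -> (a <= u <= v)%N -> (v <= b)%N ->
  q u - (v - u)%:Z <= q v <= q u + (v - u)%:Z.
Proof.
move=> h /andP[au]; elim: v => [|v IH] uv vb.
  have -> : u = 0%N by lia.
  by rewrite subnn; lia.
case: (eqVneq u v.+1) => [->|ne]; first by rewrite subnn; lia.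
have /step_bound : step w (q v) v (q v.+1) by apply: h; lia.
by have := IH ltac:(lia) ltac:(lia); lia.
Qed.

Lemma opath_parity w w' q q' a b u : opath w q a b -> opath w' q' a b -> evenz (q a - q' a) ->
  (a <= u <= b)%N -> evenz (q u - q' u).
Proof.
move=> h h' e; elim: u => [|u IH] ub; first by have <- : a = 0%N by lia.
case: (eqVneq a u.+1) => [<-//|ne].
have [k hk] := IH ltac:(lia).
have /step_diff s1 : step w (q u) u (q u.+1) by apply: h; lia.
have /step_diff s2 : step w' (q' u) u (q' u.+1) by apply: h'; lia.
by case: s1 => ->; case: s2 => ->; [exists k|exists (k + 1)|exists (k - 1)|exists k]; lia.
Qed.

(* Paths at even distance cannot jump over each other *)
Lemma pmax_step w w' q q' a b u : opath w q a b -> opath w' q' a b -> evenz (q a - q' a) ->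
  (a <= u < b)%N ->
  [/\ pmax q q' u = q u, pmax q q' u.+1 = q u.+1, q' u <= q u & q' u.+1 <= q u.+1] \/
  (pmax q q' u = q' u /\ pmax q q' u.+1 = q' u.+1).
Proof.
move=> h h' e ub; have [k hk] := opath_parity h h' e (u := u) ltac:(lia).
have /step_diff s1 : step w (q u) u (q u.+1) by exact: h.
have /step_diff s2 : step w' (q' u) u (q' u.+1) by exact: h'.
rewrite /pmax; case: s1 => e1; case: s2 => e2; case: (leP (q u) (q' u)) => c1; case: (leP (q u.+1) (q' u.+1)) => c2;
  first [by right | by left; split; lia | by left; split => //; lia | right; split; lia].
Qed.

Lemma pmax_ge q q' u : q u <= pmax q q' u /\ q' u <= pmax q q' u.
Proof. by rewrite /pmax; case: ifP; lia. Qed.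

Lemma opath_pmax w q q' a b : opath w q a b -> opath w q' a b -> evenz (q a - q' a) ->
  opath w (pmax q q') a b.
Proof.
move=> h h' e u ub.
by case: (pmax_step h h' e ub) => [[-> -> _ _]|[-> ->]]; [exact: h|exact: h'].
Qed.

Lemma step_mono (w w' : config) x t y : (forall e, w e -> w' e) -> step w x t y -> step w' x t y.
Proof. by move=> h [] [-> /h]; [left|right]. Qed.

Lemma opath_mono (w w' : config) q a b : (forall e, w e -> w' e) -> opath w q a b -> opath w' q a b.
Proof. by move=> h o u ub; apply: step_mono h _; exact: o. Qed.

Lemma xi_path (A : set int) n w y :
  xi cfg_coord A n w y <-> exists q, [/\ A (q 0%N), q n = y & opath w q 0 n].
Proof.
elim: n y => [|n IH] y; split=> /=.
- by move=> Ay; exists (fun=> y); split => // u; rewrite ltn0 andbF.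
- by case=> q [Aq <- _].
- case=> x [/IH [q [Aq qx o]] h].
  exists (join_at n q (fun=> y)); split; first by rewrite join_atL.
    by rewrite /join_at ltnn.
  move=> u /andP[_ un]; case: (ltngtP u n) => [un'|un'|->]; first 1 last.
  + by lia.
  + by rewrite /join_at leqnn ltnn qx.
  by rewrite /join_at un' (ltnW un'); apply: o.
- case=> q [Aq <- o]; exists (q n); split.
    by apply/IH; exists q; split => //; apply: opath_sub o.
  by apply: o; rewrite leq0n ltnSn.
Qed.

Lemma xi_coord (Omega : Type) (X : bond -> Omega -> bool) A n w :
  xi X A n w = xi cfg_coord A n (fun e => X e w).
Proof. by elim: n => //= n ->. Qed.

Lemma zeta_ind_coord (Omega : Type) (X : bond -> Omega -> bool) A n w :
  zeta_ind X A n w = zeta_ind cfg_coord A n (fun e => X e w).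
Proof. by rewrite /zeta_ind /zeta xi_coord. Qed.

Lemma alive_path n w : alive cfg_coord n w <-> exists q, q 0%N = 0 /\ opath w q 0 n.
Proof.
split=> [[y /xi_path [q [/= q0 _ o]]]|[q [q0 o]]]; first by exists q.
by exists (q n); apply/xi_path; exists q.
Qed.

Lemma shift_path w q y t m : opath (translate y t w) q 0 m <->
  opath w (fun u => q (u - t)%N + y) t (t + m).
Proof.
split=> h u ub.
  have := h (u - t)%N ltac:(lia); rewrite /step /translate /= /shift_bond /= subnK; last by lia.
  have -> : (u.+1 - t = (u - t).+1)%N by lia.
  by case=> -[-> ->]; [left|right]; split => //; ring.
have := h (u + t)%N ltac:(lia); rewrite /step /translate /= /shift_bond /= addnK.
have -> : ((u + t).+1 - t = u.+1)%N by lia.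
by case=> -[e ->]; [left|right]; split => //; lia.
Qed.

Lemma xi_shift y t m w z : xi cfg_coord [set 0] m (translate y t w) z <->
  exists q, [/\ q t = y, q (t + m)%N = z + y & opath w q t (t + m)].
Proof.
rewrite xi_path; split=> -[q [/= h1 h2 h3]].
  exists (fun u => q (u - t)%N + y); split; last exact/shift_path.
    by rewrite subnn h1 add0r.
  by rewrite addKn h2.
exists (fun u => q (u + t)%N - y); split; first by rewrite add0n h1 subrr.
  by rewrite addnC h2 addrK.
apply/shift_path; apply: opath_ext h3 => u ub /=.
by rewrite subnK ?subrK //; lia.
Qed.

Lemma shift_bond_inj y t : injective (shift_bond y t).
Proof. by move=> [[x u] b] [[x' u'] b'] [/addIr -> /addIn -> ->]. Qed.

(** * Finite boxes, light cones and survival probabilities *)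

Definition ints (W : nat) : seq int := [seq i%:Z - W%:Z | i <- iota 0 W.*2.+1].

Definition box (W n : nat) : seq bond :=
  undup [seq (xu, b) | xu <- [seq (x, u) | x <- ints W, u <- iota 0 n], b <- [:: true; false]].

Arguments ints : simpl never.
Arguments box : simpl never.

Lemma mem_ints W x : (x \in ints W) = (- W%:Z <= x <= W%:Z).
Proof.
apply/mapP/idP => [[i]|h]; first by rewrite mem_iota => ? ->; lia.
by exists (absz (x + W%:Z)); rewrite ?mem_iota; lia.
Qed.

Lemma size_ints W : size (ints W) = W.*2.+1.
Proof. by rewrite size_map size_iota. Qed.

Lemma mem_box W n x u b : ((x, u, b) \in box W n) = (- W%:Z <= x <= W%:Z) && (u < n)%N.
Proof.
rewrite mem_undup -mem_ints; apply/idP/idP.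
  move=> /allpairsP[[xu b'] [h _ [exu _]]]; move: h; rewrite -exu.
  move=> /allpairsP[[x2 u2] [h1 h2 [-> ->]]].
  by rewrite h1; rewrite mem_iota in h2.
move=> /andP[hx hu]; apply/allpairsP; exists ((x, u), b); split=> //; last by case: b.
by apply/allpairsP; exists (x, u); rewrite mem_iota.
Qed.

Lemma uniq_box W n : uniq (box W n). Proof. exact: undup_uniq. Qed.

(** The light cone of (y, t): paths have speed one, so those leaving this site use only these bonds
    in the next [m] steps. *)
Definition cone (y : int) (t m : nat) : set bond :=
  [set e | [/\ (t <= e.1.2)%N, (e.1.2 < t + m)%N,
               y - (e.1.2 - t)%:Z <= e.1.1 & e.1.1 <= y + (e.1.2 - t)%:Z]].

Lemma opath_dep (D : set bond) w w' q a b :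
  (forall e, D e -> w e = w' e) -> (forall u d, (a <= u < b)%N -> D (q u, u, d)) ->
  opath w q a b -> opath w' q a b.
Proof.
move=> ww' h o u ub; have := o u ub; rewrite /step !ww' //; by exact: h.
Qed.

Lemma cone_opath w q y t m u d : opath w q t (t + m) -> q t = y -> (t <= u < t + m)%N ->
  cone y t m (q u, u, d).
Proof.
move=> o e ub; have := @opath_drift _ _ _ _ t u o ltac:(lia) ltac:(lia).
by rewrite /cone /= e => ?; split; lia.
Qed.

Definition alive_from (y : int) (t m : nat) (w : config) : Prop :=
  exists q, q t = y /\ opath w q t (t + m).

(** Survival for [L] steps of the dual process, which follows the open bonds backwards in time from
    (z, t). *)
Definition dual_alive (z : int) (t L : nat) (w : config) : Prop :=
  exists q, q t = z /\ opath w q (t - L) t.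

Definition rho {R : realType} (p : R) (n : nat) : R := prob p (box n n) (alive cfg_coord n).

(* Union bound over the 2n+1 possible starting points, which spares a time reversal *)
Definition rdual {R : realType} (p : R) (n : nat) : R := (n.*2.+1)%:R * rho p n.

Lemma alive_shift y t m w : alive cfg_coord m (translate y t w) <-> alive_from y t m w.
Proof.
split=> [[z /xi_shift [q [h1 _ h2]]]|[q [h1 h2]]]; first by exists q.
by exists (q (t + m)%N - y); apply/xi_shift; exists q; rewrite subrK.
Qed.

Lemma alive_from_incr y t m : incr (alive_from y t m).
Proof. by move=> w w' h [q [e o]]; exists q; split=> //; exact: opath_mono o. Qed.

Lemma dual_alive_incr z t L : incr (dual_alive z t L).
Proof. by move=> w w' h [q [e o]]; exists q; split=> //; exact: opath_mono o. Qed.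

Lemma xi_dep (y : int) n : dep (cone y 0 n) (xi cfg_coord [set y] n).
Proof.
move=> w w' ww'; apply/seteqP; split=> z /xi_path [q [/= e <- o]]; apply/xi_path; exists q; split=> //.
  exact: opath_dep ww' (fun u d => cone_opath d o e) o.
exact: opath_dep (fun x Dx => esym (ww' x Dx)) (fun u d => cone_opath d o e) o.
Qed.

Lemma alive_dep n : dep (cone 0 0 n) (alive cfg_coord n).
Proof. by move=> w w' /xi_dep h; rewrite /alive /= h. Qed.

Lemma zeta_ind_dep n : dep (cone 0 0 n) (zeta_ind cfg_coord [set 0] n).
Proof. by move=> w w' /xi_dep h; rewrite /zeta_ind /zeta h. Qed.

Lemma shift_cone w w' y t m : (forall e, cone y t m e -> w e = w' e) ->
  forall e, cone 0 0 m e -> translate y t w e = translate y t w' e.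
Proof.
move=> h [[x u] b]; rewrite /cone /= => -[h1 h2 h3 h4]; rewrite /translate /shift_bond /=; apply: h.
by rewrite /cone /=; split; lia.
Qed.

Lemma cone_box n : cone 0 0 n `<=` [set e | e \in box n n].
Proof. by move=> [[x u] b]; rewrite /cone /= mem_box => -[? ? ? ?]; lia. Qed.

Section cone_prob.
Context {R : realType} (p : R) (p0 : 0 <= p) (p1 : p <= 1).

Lemma esp_shift s y t m (F : config -> R) : uniq s ->
  dep [set e | e \in box m m] F -> {subset [seq shift_bond y t e | e <- box m m] <= s} ->
  esp p s (fun w => F (translate y t w)) = esp p (box m m) F.
Proof.
move=> us hF sub; rewrite -(esp_relabel p _ F (@shift_bond_inj y t)).
pose D := [pred e | e \in [seq shift_bond y t e | e <- box m m]].
apply: (esp_irrel p (D := D)) => //.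
- move=> w w' h; apply: hF => e he; apply: h => /=.
  by apply/mapP; exists e.
- by rewrite (map_inj_uniq (@shift_bond_inj y t)) uniq_box.
- by move=> e De; rewrite sub.
Qed.

(** Only an inequality, because [s] may miss bonds of the translated box; adding them raises the
    probability to exactly [rho p m], by translation invariance. *)
Lemma prob_alive_from s y t m : uniq s -> prob p s (alive_from y t m) <= rho p m.
Proof.
move=> us; pose s' := undup (s ++ [seq shift_bond y t e | e <- box m m]).
have us' : uniq s' by exact: undup_uniq.
have ss' : {subset s <= s'} by move=> e; rewrite mem_undup mem_cat => ->.
apply: le_trans (prob_superset p0 p1 us us' ss' (alive_from_incr (y := y) (t := t) (m := m))) _.
rewrite /rho /prob -(@esp_shift s' y t m) //.
- by rewrite le_eqVlt; apply/orP; left; apply/eqP/esp_ext => w; apply: ind_eq; rewrite alive_shift.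
- by apply: dep_ind; apply: dep_sub (@alive_dep m); exact: cone_box.
- by move=> e; rewrite mem_undup mem_cat => ->; rewrite orbT.
Qed.

Lemma prob_dual_alive s z t L : uniq s -> (L <= t)%N -> prob p s (dual_alive z t L) <= rdual p L.
Proof.
move=> us Lt.
apply: (@le_trans _ _ (prob p s (fun w => exists2 i, i \in ints L & alive_from (z + i) (t - L) L w))).
  apply: prob_le => // w [q [e o]]; exists (q (t - L)%N - z).
    have := @opath_drift _ _ _ _ (t - L)%N t o ltac:(lia) ltac:(lia).
    by rewrite mem_ints e; lia.
  by exists q; split; [ring|rewrite subnK].
apply: le_trans (prob_exists p0 p1 _ _ _) _.
apply: (@le_trans _ _ (\sum_(i <- ints L) rho p L)).
  by apply: ler_sum => i _; exact: prob_alive_from.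
by rewrite big_const_seq count_predT size_ints iter_addr_0 /rdual mulr_natl.
Qed.

Lemma rho_ge0 n : 0 <= rho p n. Proof. exact: prob_ge0. Qed.

Lemma rdual_ge0 n : 0 <= rdual p n. Proof. by rewrite mulr_ge0 ?rho_ge0. Qed.

End cone_prob.

(** * The rightmost path *)

Definition rmost (w : config) (B : set int) (n : nat) (g : nat -> int) : Prop :=
  [/\ B (g 0%N), opath w g 0 n &
      forall q, B (q 0%N) -> opath w q 0 n -> forall u, (u <= n)%N -> q u <= g u].

Definition walk (g : nat -> int) (n : nat) : Prop :=
  forall u, (u < n)%N -> g u.+1 = g u + 1 \/ g u.+1 = g u - 1.

Definition on_path (g : nat -> int) (n : nat) : set bond :=
  [set e | [/\ (e.1.2 < n)%N, e.1.1 = g e.1.2 &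
               g e.1.2.+1 = if e.2 then e.1.1 + 1 else e.1.1 - 1]].

(** The second case is the bond leaving [g] to the right where [g] itself steps to the left. With it
    the set contains every bond off [g] that a path weakly to the right of [g] can use, and still
    avoids the bonds of [g]. *)
Definition right_of (g : nat -> int) : set bond :=
  [set e | g e.1.2 < e.1.1 \/
           [/\ e.1.1 = g e.1.2, e.2 = true & g e.1.2.+1 = g e.1.2 - 1]].

(* Opening the bonds of g turns the event that g is rightmost into one that depends
   only on the bonds to the right of g. *)
Definition opened (g : nat -> int) (n : nat) (w : config) : config :=
  fun e => w e || `[< on_path g n e >].

Definition overtaken (B : set int) (n : nat) (g : nat -> int) (w : config) : Prop :=
  exists q, [/\ B (q 0%N), opath (opened g n w) q 0 n & exists2 u, (u <= n)%N & g u < q u].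

(* [s] is a local cut time of [g] when no other path from B reaches level s
   close enough to interact with g before level n. *)
Definition cut_at (B : set int) (n : nat) (g : nat -> int) (s : nat) (w : config) : Prop :=
  forall q, B (q 0%N) -> opath w q 0 s -> ~ (g s < q s <= g s + (2 * (n - s))%:Z).

(** Failure of a cut, recast as an increasing event on the bonds to the right of [g]: the bonds of
    [g] count as open, and the obstructing path may not go to the left of [g]. In this form Harris'
    inequality applies to it. *)
Definition obstructed (B : set int) (n : nat) (g : nat -> int) (s : nat) (w : config) : Prop :=
  exists q, [/\ B (q 0%N), opath (opened g n w) q 0 s, forall u, (u <= s)%N -> g u <= q u &
                g s < q s <= g s + (2 * (n - s))%:Z].

(** The only way in which one of the [K] sites nearest to the tip of [g] can be occupied without
    being reachable through a point of [g] at a level n - M or later. *)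
Definition left_intruder (K M n : nat) (g : nat -> int) (w : config) : Prop :=
  exists2 k, (k \in iota 0 K) & exists q, [/\ opath w q (n - M) n, q n = g n - (2 * k)%:Z &
    forall u, (n - M <= u <= n)%N -> q u < g u].

Lemma opath_walk w g n : opath w g 0 n -> walk g n.
Proof. by move=> o u un; apply: (@step_diff w); apply: o. Qed.

Lemma opened_mono g n (w w' : config) : (forall e, w e -> w' e) ->
  forall e, opened g n w e -> opened g n w' e.
Proof. by move=> h e; rewrite /opened => /orP[/h ->|->] //; rewrite orbT. Qed.

Lemma on_path_open (w : config) g n e : opath w g 0 n -> on_path g n e -> w e.
Proof.
move=> o; case: e => -[x u] b [/= un xg e].
have := o u; rewrite leq0n un => /(_ isT).
by rewrite -xg; case: b e => e; case=> -[e' //]; rewrite e in e'; lia.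
Qed.

Lemma opened_id w g n : opath w g 0 n -> opened g n w = w.
Proof.
move=> o; apply: funext => e; rewrite /opened.
case: asboolP => h; last by rewrite orbF.
by rewrite orbT (on_path_open o h).
Qed.

Lemma opath_opened w g n : walk g n -> opath (opened g n w) g 0 n.
Proof.
move=> h u /andP[_ un]; case: (h u un) => e; [left|right]; split=> //; rewrite /opened;
  by apply/orP; right; apply/asboolP; split.
Qed.

(** Such a path uses only bonds of [g], which have been opened anyway, and bonds to the right of
    [g]. *)
Lemma opath_opened_right (w w' : config) g n q a b : walk g n -> (b <= n)%N ->
  (forall u, (a <= u <= b)%N -> g u <= q u) -> (forall e, right_of g e -> w e = w' e) ->
  opath (opened g n w) q a b -> opath (opened g n w') q a b.
Proof.
move=> wg bn ge ww' o u ub; have g1 := ge u ltac:(lia); have g2 := ge u.+1 ltac:(lia).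
have wu := wg u ltac:(lia).
have key d : q u.+1 = (if d then q u + 1 else q u - 1) ->
    opened g n w (q u, u, d) -> opened g n w' (q u, u, d).
  move=> e; rewrite /opened => /orP[h|->]; last by rewrite orbT.
  have [gq|qg|gq] := ltgtP (g u) (q u).
  - by rewrite -ww' ?h //; left.
  - by lia.
  - case: (eqVneq (g u.+1) (q u.+1)) => [e'|ne].
      apply/orP; right; apply/asboolP; split=> /=; first by lia.
        by rewrite gq.
      by rewrite e' e.
    rewrite -ww' ?h //; right; case: d e {h} => /= e; split=> //; lia.
by case: (o u ub) => -[e h]; [left|right]; split=> //; apply: key.
Qed.

(** A bond of [g] has both ends on [g], so a step with one end strictly to the right of [g] was open
    before the bonds of [g] were opened. *)
Lemma opath_opened_off w g n q a b :
  (forall u, (a <= u < b)%N -> g u < q u \/ g u.+1 < q u.+1) ->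
  opath (opened g n w) q a b -> opath w q a b.
Proof.
move=> off o u ub.
have key d : q u.+1 = (if d then q u + 1 else q u - 1) ->
    opened g n w (q u, u, d) -> w (q u, u, d).
  move=> e; rewrite /opened => /orP[//|/asboolP[/= _ e1 e2]].
  by case: d e e2 => /= e e2; case: (off u ub); lia.
by case: (o u ub) => -[e h]; [left|right]; split=> //; apply: key.
Qed.

Lemma overtaken_incr B n g : incr (overtaken B n g).
Proof.
move=> w w' h [q [h1 h2 h3]]; exists q; split=> //.
by apply: opath_mono h2; exact: opened_mono.
Qed.

Lemma obstructed_incr B n g s : incr (obstructed B n g s).
Proof.
move=> w w' h [q [h1 h2 h3]]; exists q; split=> //.
by apply: opath_mono h2; exact: opened_mono.
Qed.

(** This splits the conditioning on [g] into a condition on the bonds of [g] and a decreasing one,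
    which for even starting points and a walk [g] from [B] sees only the bonds to the right of [g];
    the bonds to the left remain free. *)
Lemma rmostE w B n g : rmost w B n g <-> [/\ B (g 0%N), opath w g 0 n & ~ overtaken B n g w].
Proof.
split=> -[h1 h2 h3]; split=> //.
  move=> [q [q1 q2 [u un gu]]]; rewrite (opened_id h2) in q2.
  by have := h3 q q1 q2 u un; lia.
move=> q q1 q2 u un; case: (leP (q u) (g u)) => // gu.
by exfalso; apply: h3; exists q; split=> //; [rewrite opened_id|exists u].
Qed.

Section even_start.
Variables (B : set int) (n : nat) (g : nat -> int).
Hypothesis evenB : forall x, B x -> evenz x.

Lemma evenB_sub x y : B x -> B y -> evenz (x - y).
Proof. by move=> /evenB[k ->] /evenB[l ->]; exists (k - l); lia. Qed.

Lemma pmax_start q q' : B (q 0%N) -> B (q' 0%N) -> B (pmax q q' 0%N).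
Proof. by rewrite /pmax; case: ifP. Qed.

(** If [q] overtakes [g], then so does the pointwise maximum of the two. It is open once the bonds
    of [g] are, and it never goes to the left of [g]. *)
Lemma overtaken_dep : walk g n -> B (g 0%N) -> dep (right_of g) (overtaken B n g).
Proof.
move=> wg Bg; apply: dep_prop => w w' ww' [q [h1 h2 [u un gu]]].
have o := opath_pmax h2 (opath_opened w wg) (evenB_sub h1 Bg).
exists (pmax q g); split; first exact: pmax_start.
  by apply: opath_opened_right ww' o => // v _; have [] := pmax_ge q g v.
by exists u => //; have [] := pmax_ge q g u; lia.
Qed.

Lemma obstructed_dep s : walk g n -> (s <= n)%N -> dep (right_of g) (obstructed B n g s).
Proof.
move=> wg sn; apply: dep_prop => w w' ww' [q [h1 h2 h3 h4]]; exists q; split=> //.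
by apply: opath_opened_right ww' h2 => // u ub; apply: h3.
Qed.

Lemma opath_on_path_dep : walk g n -> dep (on_path g n) (fun w => opath w g 0 n).
Proof.
move=> wg; apply: dep_prop => w w' ww' o u ub.
have wu := wg u ub.
by case: (o u ub) => -[e h]; [left|right]; split=> //; rewrite -ww' // /on_path /=; split.
Qed.

Lemma on_right_disj e : on_path g n e -> right_of g e -> False.
Proof. by case: e => -[x u] b [/= h1 h2 h3] [] /=; [lia|case=> h4 h5 h6; rewrite h5 in h3; lia]. Qed.

Lemma not_cut_obstructed s w : rmost w B n g -> (s <= n)%N -> ~ cut_at B n g s w ->
  obstructed B n g s w.
Proof.
move=> [Bg o mx] sn /existsNP[q] /not_implyP[Bq] /not_implyP[oq] /contrapT /andP[hq1 hq2].
have os : opath w g 0 s by apply: opath_sub o.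
exists (pmax q g); split.
- exact: pmax_start.
- by rewrite opened_id //; apply: opath_pmax oq os (evenB_sub Bq Bg).
- by move=> u _; have [] := pmax_ge q g u.
- have -> : pmax q g s = q s by rewrite /pmax; case: ifP => //; lia.
  by rewrite hq1.
Qed.

End even_start.

(** * Excursions to the right of a given path *)

Definition excursion (g : nat -> int) (L s : nat) (w : config) : Prop :=
  exists2 u, (s - L <= u < s)%N & exists q,
    [/\ opath w q u s, q u = g u & forall v, (u < v <= s)%N -> g v < q v].

Definition strip (a b : nat) : set bond := [set e | (a <= e.1.2 < b)%N].

Lemma excursion_dep g L s : dep (strip (s - L) s) (excursion g L s).
Proof.
apply: dep_prop => w w' ww' [u ub [q [oq qu h]]]; exists u => //; exists q; split=> //.
by apply: opath_dep ww' _ oq => v d vb; rewrite /strip /=; lia.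
Qed.

(** Consider the last visit of the obstructing path to [g]. If it happens at s - L or later, an
    excursion of length at most [L] ends at [s]; otherwise one of the 2(n - s) sites to the right of
    [g] at level [s] has a dual cluster of age [L]. *)
Lemma obstructed_excursion B n g L s w : (L <= s)%N -> obstructed B n g s w ->
  excursion g L s w \/
  exists2 i, i \in iota 1 (2 * (n - s)) & dual_alive (g s + i%:Z) s L w.
Proof.
move=> Ls [q [Bq o ge /andP[gq1 gq2]]].
pose P u := ((u <= s)%N && (q u == g u)).
case: (pselect (exists u, (s - L <= u)%N && P u)) => [exu|nou].
  have bnd u : (s - L <= u)%N && P u -> (u <= s)%N by rewrite /P; lia.
  have [u /andP[u1 /andP[u2 /eqP u3]] umax] := ex_maxnP exu bnd.
  left; exists u.
    by case: (eqVneq u s) => [us|]; [rewrite us in u3; lia|lia].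
  have off v : (u < v <= s)%N -> g v < q v.
    move=> vb; rewrite lt_neqAle ge ?andbT; last by lia.
    by apply/eqP => e; have := umax v; rewrite /P e eqxx; lia.
  exists q; split=> //; apply: (@opath_opened_off w g n).
    by move=> v vb; right; apply: off; lia.
  by apply: opath_sub o; lia.
right; exists (absz (q s - g s)); first by rewrite mem_iota; lia.
exists q; split; first by lia.
apply: (@opath_opened_off w g n); last by apply: opath_sub o.
move=> v vb; right; rewrite lt_neqAle ge ?andbT; last by lia.
by apply/eqP => e; apply: nou; exists v.+1; rewrite /P e eqxx; lia.
Qed.

(** Two paths separate by at most 2 per step, so an excursion that ends at distance 2k has lasted at
    least [k] steps. Tying the age to the distance in this way leads to a convergent product over
    [k] instead of a union bound that may exceed 1. *)
Lemma excursion_dual g L s w : (L <= s)%N -> walk g s -> excursion g L s w ->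
  exists2 k, (k \in iota 1 L) & dual_alive (g s + 2 * k%:Z) s k w.
Proof.
move=> Ls wg [u ub [q [oq qu h]]].
have og : opath (opened g s w) g u s by apply: opath_sub (opath_opened w wg).
have [k hk] : evenz (q s - g s).
  apply: opath_parity oq og _ _; last by lia.
  by exists 0; rewrite qu; ring.
have h1 := h s ltac:(lia).
have h2 := @opath_drift _ _ _ _ u s oq ltac:(lia) ltac:(lia).
have h3 := @opath_drift _ _ _ _ u s og ltac:(lia) ltac:(lia).
exists (absz k); first by rewrite mem_iota; lia.
exists q; split; first by lia.
by apply: opath_sub oq; lia.
Qed.

Section conditioning.
Context {R : realType} (p : R) (p0 : 0 <= p) (p1 : p <= 1).
Variables (B : set int) (n : nat) (g : nat -> int).
Hypothesis evenB : forall x, B x -> evenz x.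

Lemma prob_false s : prob p s (fun=> False) = 0.
Proof. by rewrite -[RHS](esp_cst p s 0); apply: esp_ext => w; rewrite ind_false. Qed.

Lemma rmost_impossible s (Q : config -> Prop) : ~ (B (g 0%N) /\ walk g n) ->
  prob p s (fun w => rmost w B n g /\ Q w) = 0.
Proof.
move=> h; rewrite -(prob_false s); apply: prob_eq => w; split=> // -[[h1 h2 _] _].
by apply: h; split=> //; exact: opath_walk h2.
Qed.

(* Right of the rightmost path the bonds are conditioned negatively (Harris). *)
Lemma prob_rmost_no_cut s (r : seq nat) : (forall i, i \in r -> (i <= n)%N) ->
  prob p s (fun w => rmost w B n g /\ forall i, i \in r -> ~ cut_at B n g i w) <=
  prob p s (fun w => rmost w B n g) *
  prob p s (fun w => forall i, i \in r -> obstructed B n g i w).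
Proof.
move=> rn; case: (pselect (B (g 0%N) /\ walk g n)) => [[Bg wg]|h]; last first.
  by rewrite rmost_impossible // mulr_ge0 // prob_ge0.
have dov : dep (right_of g) (overtaken B n g) by exact: overtaken_dep.
have dob : dep (right_of g) (fun w => forall i, i \in r -> obstructed B n g i w).
  apply: dep_prop => w w' ww' h i ir.
  by rewrite -(obstructed_dep B wg (rn i ir) ww'); exact: h.
have dop := opath_on_path_dep wg.
have disj := @on_right_disj n g.
have -> : prob p s (fun w => rmost w B n g) =
    prob p s (fun w => opath w g 0 n) * prob p s (fun w => ~ overtaken B n g w).
  rewrite -(prob_indep p s dop (dep_not dov) disj); apply: prob_eq => w.
  by rewrite rmostE; split=> [[]|[]].
rewrite -mulrA; apply: le_trans (ler_wpM2l (prob_ge0 p0 p1 _ _) (prob_harris_mix p0 p1 _ _ _)).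
- rewrite -(prob_indep p s dop (dep_and (dep_not dov) dob) disj); apply: prob_le => // w [hr hc].
  have [_ h1 h2] := (rmostE _ _ _ _).1 hr.
  split=> //; split=> // i ir; apply: not_cut_obstructed => //; [exact: rn|exact: hc].
- exact: overtaken_incr.
- by move=> w w' ww' h i ir; apply: obstructed_incr ww' _; exact: h.
Qed.

Lemma left_intruder_dep K M : (M <= n)%N ->
  dep [set e : bond | e.1.1 < g e.1.2] (left_intruder K M n g).
Proof.
move=> Mn; apply: dep_prop => w w' ww' [k kK [q [oq qn h]]]; exists k => //; exists q; split=> //.
by apply: opath_dep ww' _ oq => u d ub /=; apply: h; lia.
Qed.

Lemma prob_left_intruder s K M : uniq s -> (M <= n)%N ->
  prob p s (left_intruder K M n g) <= K%:R * rdual p M.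
Proof.
move=> us Mn; apply: (@le_trans _ _
  (prob p s (fun w => exists2 k, k \in iota 0 K & dual_alive (g n - (2 * k)%:Z) n M w))).
  by apply: prob_le => // w [k kK [q [oq qn h]]]; exists k => //; exists q.
apply: le_trans (prob_exists p0 p1 _ _ _) _.
apply: (@le_trans _ _ (\sum_(i <- iota 0 K) rdual p M)).
  by apply: ler_sum => i _; exact: prob_dual_alive.
by rewrite big_const_seq count_predT size_iota iter_addr_0 mulr_natl.
Qed.

(* Left of the rightmost path the bonds are unconditioned. *)
Lemma prob_rmost_intruder s K M : uniq s -> (M <= n)%N ->
  prob p s (fun w => rmost w B n g /\ left_intruder K M n g w) <=
  prob p s (fun w => rmost w B n g) * (K%:R * rdual p M).
Proof.
move=> us Mn; case: (pselect (B (g 0%N) /\ walk g n)) => [[Bg wg]|h]; last first.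
  by rewrite rmost_impossible // !mulr_ge0 ?prob_ge0 ?rdual_ge0.
have dr : dep (on_path g n `|` right_of g) (fun w => rmost w B n g).
  apply: dep_prop => w w' ww' /rmostE[h1 h2 h3]; apply/rmostE; split=> //.
    by rewrite -(opath_on_path_dep wg (w := w)) // => e he; apply: ww'; left.
  by rewrite -(overtaken_dep evenB wg Bg (w := w)) // => e he; apply: ww'; right.
rewrite (prob_indep p s dr (left_intruder_dep K Mn)).
  by apply: ler_wpM2l; [exact: prob_ge0|exact: prob_left_intruder].
by move=> [[x u] b] [[/= h1 h2 h3]|[/= h1|[/= h1 h2 h3]]] /= h4; lia.
Qed.

(** Here [r k] bounds the probability that a dual cluster lives for [k] steps, and [d] is a lower
    bound, uniform in [L], for the probability that no excursion of length at most [L] ends at a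
    given time. *)
Variable r : nat -> R.
Variable d : R.
Hypothesis r_dual : forall s z t k, uniq s -> (k <= t)%N -> prob p s (dual_alive z t k) <= r k.
Hypothesis r_le1 : forall k, r k <= 1.
Hypothesis r_prod : forall L, d <= \prod_(k <- iota 1 L) (1 - r k).
Hypothesis d_le1 : d <= 1.

(* Harris' inequality for the decreasing events that the dual clusters die out *)
Lemma prob_no_dual s t L : uniq s -> (L <= t)%N ->
  \prod_(k <- iota 1 L) (1 - r k) <=
  prob p s (fun w => ~ exists2 k, k \in iota 1 L & dual_alive (g t + 2 * k%:Z) t k w).
Proof.
move=> us Lt.
have : all (fun k => (k <= t)%N) (iota 1 L) by apply/allP => k; rewrite mem_iota; lia.
elim: (iota 1 L) => [|k ks IH] /=.
  move=> _; rewrite big_nil prob_not // -[X in X <= _]subr0 lerD2l lerN2 le_eqVlt.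
  by apply/orP; left; rewrite -(prob_false s); apply/eqP/prob_eq => w; split=> // -[].
move=> /andP[kt /IH{}IH]; rewrite big_cons.
pose Q w := exists2 k, k \in ks & dual_alive (g t + 2 * k%:Z) t k w.
apply: (@le_trans _ _ (prob p s (fun w => ~ dual_alive (g t + 2 * k%:Z) t k w) * prob p s (fun w => ~ Q w))).
  apply: ler_pM => //; first by rewrite subr_ge0.
    by rewrite big_seq; apply: prodr_ge0 => i _; rewrite subr_ge0.
  by rewrite prob_not // lerD2l lerN2; exact: r_dual.
have iQ : incr Q by move=> w w' ww' [i ik h]; exists i => //; exact: dual_alive_incr ww' h.
apply: le_trans (prob_harris_decr p0 p1 _ (@dual_alive_incr _ _ _) iQ) _.
apply: prob_le => // w [h1 h2] [i]; rewrite inE => /orP[/eqP ->|ik h]; first by [].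
by apply: h2; exists i.
Qed.

Lemma prob_excursion s L t : uniq s -> (L <= t)%N -> walk g t ->
  prob p s (excursion g L t) <= 1 - d.
Proof.
move=> us Lt wg; apply: (@le_trans _ _ (prob p s (fun w =>
    exists2 k, (k \in iota 1 L) & dual_alive (g t + 2 * k%:Z) t k w))).
  by apply: prob_le => // w; exact: excursion_dual.
rewrite lerBrDr -lerBrDl -prob_not //.
exact: le_trans (r_prod L) (prob_no_dual us Lt).
Qed.

(** Times at spacing [L] confine the excursions of length at most [L] to disjoint strips, hence they
    are independent. *)
Lemma prob_all_excursion s L s0 J : uniq s -> walk g n -> (s0 + J * L <= n)%N ->
  prob p s (fun w => forall j, (j < J)%N -> excursion g L (s0 + j.+1 * L) w) <= (1 - d) ^+ J.
Proof.
move=> us wg; elim: J => [|J IH] h; first by rewrite expr0; exact: prob_le1.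
rewrite exprSr; apply: (@le_trans _ _ (prob p s (fun w =>
   (forall j, (j < J)%N -> excursion g L (s0 + j.+1 * L) w) /\ excursion g L (s0 + J.+1 * L) w))).
  by apply: prob_le => // w hw; split=> [j jJ|]; apply: hw; lia.
rewrite (@prob_indep _ p s (strip 0 (s0 + J * L)) (strip (s0 + J.+1 * L - L) (s0 + J.+1 * L))).
- apply: ler_pM; rewrite ?prob_ge0 //; first by apply: IH; lia.
  apply: prob_excursion => //; first by lia.
  by move=> u un; apply: wg; lia.
- apply: dep_prop => w w' ww' hw j jJ; rewrite -(@excursion_dep g L (s0 + j.+1 * L)%N w); first exact: hw.
  move=> e; rewrite /strip /= => he; apply: ww'; rewrite /strip /=.
  have : (j.+1 * L <= J * L)%N by rewrite leq_mul2r; lia.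
  by lia.
- exact: excursion_dep.
- by move=> e; rewrite /strip /= mulSn; lia.
Qed.

(** The [J] candidate times lie between n - 2JL and n - JL. The first bound limits the sites to be
    excluded at each of them to 4JL; the second leaves at least JL steps for the process restarted
    at the cut. *)
Lemma prob_all_obstructed s L J : uniq s -> walk g n -> (2 * (J * L) <= n)%N ->
  prob p s (fun w => forall i, i \in [seq (n - 2 * (J * L) + j.+1 * L)%N | j <- iota 0 J] ->
                     obstructed B n g i w) <=
  (1 - d) ^+ J + J%:R * ((4 * (J * L))%:R * rdual p L).
Proof.
move=> us wg h; set s0 := (n - 2 * (J * L))%N.
pose V j w := exists2 i, i \in iota 1 (2 * (n - (s0 + j.+1 * L))) &
  dual_alive (g (s0 + j.+1 * L)%N + i%:Z) (s0 + j.+1 * L) L w.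
apply: (@le_trans _ _ (prob p s (fun w =>
   (forall j, (j < J)%N -> excursion g L (s0 + j.+1 * L) w) \/ exists2 j, j \in iota 0 J & V j w))).
  apply: prob_le => // w hw; case: (pselect (exists2 j, j \in iota 0 J & V j w)); first by right.
  move=> nV; left => j jJ.
  have jJ' : j \in iota 0 J by rewrite mem_iota.
  have /hw ho : (s0 + j.+1 * L)%N \in [seq (s0 + j.+1 * L)%N | j <- iota 0 J].
    by apply/mapP; exists j.
  have Ls : (L <= s0 + j.+1 * L)%N by rewrite mulSn; lia.
  case: (obstructed_excursion Ls ho) => // hV.
  by exfalso; apply: nV; exists j.
apply: le_trans (prob_or p0 p1 _ _ _) _; apply: lerD.
  by apply: prob_all_excursion => //; rewrite /s0; lia.
apply: le_trans (prob_exists p0 p1 _ _ _) _.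
apply: (@le_trans _ _ (\sum_(j <- iota 0 J) (4 * (J * L))%:R * rdual p L)); last first.
  by rewrite big_const_seq count_predT size_iota iter_addr_0 -[leLHS]mulr_natl.
rewrite big_seq [leRHS]big_seq; apply: ler_sum => j; rewrite mem_iota => jJ.
apply: le_trans (prob_exists p0 p1 _ _ _) _.
apply: (@le_trans _ _ (\sum_(i <- iota 1 (2 * (n - (s0 + j.+1 * L)))) rdual p L)).
  by apply: ler_sum => i _; apply: prob_dual_alive => //; lia.
rewrite big_const_seq count_predT size_iota iter_addr_0 -[leLHS]mulr_natl.
apply: ler_wpM2r; first exact: rdual_ge0.
by rewrite ler_nat /s0; lia.
Qed.

End conditioning.

Lemma rmost_ext w B n g g' : (forall u, (u <= n)%N -> g u = g' u) ->
  rmost w B n g -> rmost w B n g'.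
Proof.
move=> e [h1 h2 h3]; split; first by rewrite -e.
  by apply: opath_ext h2 => u /andP[_]; exact: e.
by move=> q q1 q2 u un; rewrite -e //; exact: h3.
Qed.

Lemma rmost_uniq w B n g g' : rmost w B n g -> rmost w B n g' ->
  forall u, (u <= n)%N -> g u = g' u.
Proof.
move=> [h1 h2 h3] [h1' h2' h3'] u un; apply/eqP.
by rewrite eq_le h3 // h3'.
Qed.

(** An open path from [B] with the largest sum of positions is rightmost, since its pointwise
    maximum with another such path is again an open path from [B]. *)
Lemma rmost_exists w B n (W : int) q : (forall x, B x -> evenz x) -> (forall x, B x -> x <= W) ->
  B (q 0%N) -> opath w q 0 n -> exists2 g, rmost w B n g & forall u, (n < u)%N -> g u = 0.
Proof.
move=> evenB BW Bq oq.
(* The total deficit below the a priori bound W + n: a natural number, to be minimised. *)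
pose height (g : nat -> int) := (\sum_(u < n.+1) absz (W + n%:Z - g u)%R)%N.
pose P m := `[< exists g, [/\ B (g 0%N), opath w g 0 n & height g = m] >].
have exP : exists m, P m by exists (height q); apply/asboolP; exists q.
have [m /asboolP[g [Bg og hg]] mmin] := ex_minnP exP.
pose g' u := if (u <= n)%N then g u else 0.
exists g'; last by move=> u; rewrite /g' ltnNge => /negbTE ->.
apply: (@rmost_ext w B n g); first by move=> u un; rewrite /g' un.
split=> // q' Bq' oq' u un; case: (leP (q' u) (g u)) => // lt; exfalso.
have oM := opath_pmax og oq' (evenB_sub evenB Bg Bq').
have BM := @pmax_start B g q' Bg Bq'.
have bound r v : B (r 0%N) -> opath w r 0 n -> (v <= n)%N -> r v <= W + n%:Z.
  move=> Br orr vn; have := @opath_drift w r 0 n 0 v orr ltac:(lia) ltac:(lia).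
  by have := BW _ Br; lia.
have : (m <= height (pmax g q'))%N by apply: mmin; apply/asboolP; exists (pmax g q').
rewrite -hg /height leqNgt => /negP; apply.
have un' : (u < n.+1)%N by lia.
rewrite (bigD1 (Ordinal un')) //= [X in (_ < X)%N](bigD1 (Ordinal un')) //= -addSn.
apply: leq_add.
  have -> : pmax g q' u = q' u by rewrite /pmax; case: ifP => //; lia.
  by have := bound _ _ Bq' oq' un; lia.
apply: leq_sum => i _; have [h _] := pmax_ge g q' i.
by have := bound _ i BM oM ltac:(have := ltn_ord i; lia); lia.
Qed.

(** The value 0 beyond level [n] makes the rightmost path unique as a function, so that
    [esp_cond_le] can condition on it. *)
Definition rpath (B : set int) (n : nat) (w : config) : option (nat -> int) :=
  match pselect (exists2 g, rmost w B n g & forall u, (n < u)%N -> g u = 0) with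
  | left h => Some (projT1 (cid2 h))
  | right _ => None
  end.

Lemma rpathP B n w g : rpath B n w = Some g <-> rmost w B n g /\ (forall u, (n < u)%N -> g u = 0).
Proof.
rewrite /rpath; case: pselect => [h|h]; last first.
  by split=> // -[h1 h2]; exfalso; apply: h; exists g.
case: (cid2 h) => g' h1 h2 /=; split=> [[<-] //|[h3 h4]]; congr Some.
apply: funext => u; case: (leqP u n) => un; last by rewrite h2 ?h4.
exact: rmost_uniq h1 h3 u un.
Qed.

Lemma prob_rmost_cond (R : realType) (p : R) (p0 : 0 <= p) (p1 : p <= 1) s B n
  (Q : (nat -> int) -> config -> Prop) (c : R) : 0 <= c ->
  (forall g, prob p s (fun w => rmost w B n g /\ Q g w) <= prob p s (fun w => rmost w B n g) * c) ->
  prob p s (fun w => exists2 g, rmost w B n g /\ (forall u, (n < u)%N -> g u = 0) & Q g w) <= c.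
Proof.
move=> c0 h; rewrite -[leRHS](esp_cst p s c).
apply: (esp_cond_le (v := rpath B n)) => -[g|]; last first.
  apply: esp_le => // w; case: (pselect (rpath B n w = None)) => e; last by rewrite ind_false // !mul0r.
  rewrite (ind_true e) !mul1r ind_false // => -[g /rpathP]; by rewrite e.
case: (pselect (forall u, (n < u)%N -> g u = 0)) => g0; last first.
  by apply: esp_le => // w; rewrite ind_false ?mul0r // => /rpathP[].
have e w : ind (rpath B n w = Some g) = ind (rmost w B n g) :> R.
  by apply: ind_eq; rewrite rpathP; split=> [[]|].
have -> : esp p s (fun w => ind (rpath B n w = Some g) * c) = prob p s (fun w => rmost w B n g) * c.
  by rewrite mulrC /prob -espZ; apply: esp_ext => w; rewrite e mulrC.
apply: le_trans (h g); apply: esp_le => // w; rewrite e -ind_and; apply: ind_le.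
move=> [h1 [g' [h2 h3] Qg]]; split=> //.
have /rpathP : rmost w B n g /\ (forall u, (n < u)%N -> g u = 0) by [].
by have /rpathP -> : rmost w B n g' /\ (forall u, (n < u)%N -> g' u = 0) by []; case=> <-.
Qed.

Lemma cut_at_ext B n g g' s w : g s = g' s -> cut_at B n g s w -> cut_at B n g' s w.
Proof. by move=> e h q q1 q2; rewrite -e; exact: h. Qed.

(** * The first local cut time and the renewal at it *)

Section first_cut.
Variables (B : set int) (n : nat) (W : int) (ts : seq nat).
Hypothesis evenB : forall x, B x -> evenz x.
Hypothesis BW : forall x, B x -> x <= W.
Hypothesis tsn : forall t, t \in ts -> (t <= n)%N.

Definition first_cut (t : nat) (y : int) (w : config) : Prop :=
  exists g, [/\ rmost w B n g, g t = y, cut_at B n g t w &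
                forall i, i \in ts -> (i < t)%N -> ~ cut_at B n g i w].

(** The part of [first_cut] that can be read off outside the cone of (y, t). Domination by [g] is
    asked only of paths with q t <= y: at level [t] other paths may well exist beyond the gap, and
    for these the last clause demands death before level [n]. *)
Definition cut_past (t : nat) (y : int) (w : config) : Prop :=
  (exists g, [/\ [/\ B (g 0%N), opath w g 0 t & g t = y],
     forall q, B (q 0%N) -> opath w q 0 t -> q t <= y -> forall u, (u <= t)%N -> q u <= g u,
     cut_at B n g t w & forall i, i \in ts -> (i < t)%N -> ~ cut_at B n g i w]) /\
  (forall q, B (q 0%N) -> opath w q 0 n -> ~ (y + (2 * (n - t))%:Z < q t)).

(* At a local cut time the past and the cone of (t, y) decouple: paths from B that are
   beyond the gap at level t cannot enter this cone before level n. *)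
Lemma first_cutE t y w : (t <= n)%N ->
  first_cut t y w <-> cut_past t y w /\ alive_from y t (n - t) w.
Proof.
move=> tn; split.
  move=> [g [[Bg og mx] gt ct nc]].
  have ogt : opath w g 0 t by apply: opath_sub og.
  split; last by exists g; rewrite subnKC //; split=> //; apply: opath_sub og.
  split; last by move=> q Bq oq; have := mx q Bq oq t tn; lia.
  exists g; split=> // q Bq oq qt u ut.
  (* A path to level [t] that beats [g] somewhere, continued along [g] after [t], would beat [g] up
     to level [n]. *)
  have Bm := @pmax_start B q g Bq Bg.
  have om := opath_pmax oq ogt (evenB_sub evenB Bq Bg).
  have mt : pmax q g t = g t by rewrite /pmax; case: ifP => //; lia.
  have ogl : opath w (join_at t (pmax q g) g) 0 n.
    by apply: opath_join om _ _ => //; apply: opath_sub og.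
  have := mx (join_at t (pmax q g) g) ltac:(rewrite join_atL //) ogl u ltac:(lia).
  by rewrite join_atL //; have [] := pmax_ge q g u; lia.
move=> [[[g [[Bg og gt] mx ct nc]] far] [q [qt oq]]].
rewrite subnKC // in oq.
have ogl : opath w (join_at t g q) 0 n by apply: opath_join og oq _ => //; rewrite gt qt.
have Bgl : B (join_at t g q 0%N) by rewrite join_atL.
have [g' rg' _] := rmost_exists evenB BW Bgl ogl.
have [Bg' og' mx'] := rg'.
have og't : opath w g' 0 t by apply: opath_sub og'.
(* The rightmost path is not to the left of [y], as a path through (y, t) reaches level [n]; the gap
   is excluded by the cut, and sites beyond the gap by [far]. *)
have g't : g' t = y.
  have := mx' _ Bgl ogl t tn; rewrite join_atL // gt => h.
  have := ct g' Bg' og't; rewrite gt => h1; have := far g' Bg' og' => h2.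
  apply/eqP; rewrite eq_le h andbT leNgt; apply/negP => h3.
  by case: (leP (g' t) (y + (2 * (n - t))%:Z)) => h4; [apply: h1; rewrite h3|exact: h2].
have eg u : (u <= t)%N -> g u = g' u.
  move=> ut; apply/eqP; rewrite eq_le (mx g') ?g't // andbT.
  by have := mx' _ Bgl ogl u ltac:(lia); rewrite join_atL.
exists g'; split=> //; first by apply: cut_at_ext ct; exact: eg.
move=> i its it /(cut_at_ext (esym (eg i ltac:(lia)))).
exact: nc.
Qed.

Lemma first_cut_uniq t t' y y' w : t \in ts -> t' \in ts ->
  first_cut t y w -> first_cut t' y' w -> t = t' /\ y = y'.
Proof.
move=> tts tts' [g [rg <- c nc]] [g' [rg' <- c' nc']].
have e := rmost_uniq rg rg'.
case: (ltngtP t t') => [lt|lt|tt'].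
- by case: (nc' _ tts lt (cut_at_ext (e _ (tsn tts)) c)).
- by case: (nc _ tts' lt (cut_at_ext (esym (e _ (tsn tts'))) c')).
- by split=> //; rewrite -tt' e //; exact: tsn.
Qed.

Lemma opath_before (D : set bond) w w' q t : (forall e : bond, (e.1.2 < t)%N -> D e) ->
  (forall e, D e -> w e = w' e) -> opath w q 0 t -> opath w' q 0 t.
Proof. by move=> h ww' oq; apply: opath_dep ww' _ oq => u d ub; apply: h. Qed.

Lemma cut_past_dep t y : (t <= n)%N -> dep (~` cone y t (n - t)) (cut_past t y).
Proof.
move=> tn; apply: dep_prop => w w' ww' [[g [[Bg og gt] mx ct nc]] far].
have before e : (e.1.2 < t)%N -> (~` cone y t (n - t)) e by rewrite /cone /= => h []; lia.
have w'w e : (~` cone y t (n - t)) e -> w' e = w e by move=> /ww' ->.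
have o1 q i : (i <= t)%N -> opath w q 0 i -> opath w' q 0 i.
  by move=> it; apply: opath_before ww' => e h; apply: before; lia.
have o2 q i : (i <= t)%N -> opath w' q 0 i -> opath w q 0 i.
  by move=> it; apply: opath_before w'w => e h; apply: before; lia.
have cw i : (i <= t)%N -> cut_at B n g i w <-> cut_at B n g i w'.
  by move=> it; split=> h q Bq oq; apply: h => //; [exact: o2|exact: o1].
split.
  exists g; split=> //.
  - by split=> //; exact: o1.
  - by move=> q Bq oq; apply: mx => //; exact: o2.
  - exact/cw.
  - by move=> i its it; rewrite -cw; [exact: nc|lia].
move=> q Bq oq h; apply: (far q Bq _ h).
refine (opath_dep w'w _ oq) => u d ub; rewrite /cone /= => -[h1 h2 h3 h4].
by have := @opath_drift _ _ _ _ t u oq ltac:(lia) ltac:(lia); lia.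
Qed.

Lemma exists_first_cut w g : rmost w B n g -> (exists2 t, t \in ts & cut_at B n g t w) ->
  exists2 t, t \in ts & first_cut t (g t) w.
Proof.
move=> rg [t0 t0s c0].
pose P t := (t \in ts) && `[< cut_at B n g t w >].
have exP : exists t, P t by exists t0; rewrite /P t0s; apply/asboolP.
have [t /andP[tts /asboolP ct] tmin] := ex_minnP exP.
exists t => //; exists g; split=> // i its it ci.
by have := tmin i; rewrite /P its asboolT // => /(_ isT); lia.
Qed.

End first_cut.

Lemma zeta_max (Omega : Type) (X : bond -> Omega -> bool) A n w r z : xi X A n w r ->
  (forall y, xi X A n w y -> y <= r) -> zeta X A n w z <-> xi X A n w (z + r).
Proof.
move=> xr mx; split=> [[r' [h1 [h2 h3]]]|h]; last by exists r.
by have -> : r = r' by apply/eqP; rewrite eq_le h2 //= mx.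
Qed.

(* A path that does not stay on the left of g after level n - M meets g, hence can be
   rerouted through (g t, t). *)
Lemma zeta_ind_cut w B n g K M t k : rmost w B n g -> (M <= n)%N -> (t <= n - M)%N ->
  ~ left_intruder K M n g w -> (k < K)%N ->
  zeta_ind cfg_coord B n w k = zeta_ind cfg_coord [set 0] (n - t) (translate (g t) t w) k.
Proof.
move=> [Bg og mx] Mn tM nl kK; apply: asbool_equiv_eq.
have tn : (t <= n)%N by lia.
have xiB y : xi cfg_coord B n w y -> y <= g n.
  by move=> /xi_path [q [Bq <- oq]]; exact: mx.
rewrite (zeta_max (r := g n)) //; last by apply/xi_path; exists g.
rewrite (@zeta_max _ _ _ _ _ (g n - g t)).
- rewrite xi_path xi_shift subnKC //; split.
    move=> [q [Bq qn oq]].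
    have [u ub qu] : exists2 u, (n - M <= u <= n)%N & g u <= q u.
      apply: contrapT => nex; apply: nl; exists k; first by rewrite mem_iota.
      exists q; split; [by apply: opath_sub oq|by rewrite qn; lia|].
      by move=> u ub; rewrite ltNge; apply/negP => h; apply: nex; exists u.
    have gqu : g u = q u by have := mx q Bq oq u ltac:(lia); lia.
    exists (join_at u g q); split.
    + by rewrite join_atL //; lia.
    + by rewrite join_atR //; [rewrite qn; ring|lia].
    + apply: opath_join => //; [by apply: opath_sub og; lia|by apply: opath_sub oq; lia|by lia].
  move=> [q [qt qn oq]]; exists (join_at t g q); split.
  + by rewrite join_atL.
  + by rewrite join_atR // qn; ring.
  + by apply: opath_join => //; apply: opath_sub og; lia.
- apply/xi_shift; exists g; rewrite subnKC //; split=> //; first by ring.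
  by apply: opath_sub og; lia.
- move=> y /xi_shift [q]; rewrite subnKC // => -[qt qn oq].
  have -> : y = join_at t g q n - g t by rewrite join_atR // qn; ring.
  rewrite lerD2r; apply: mx => //.
  by apply: opath_join => //; apply: opath_sub og; lia.
Qed.

(** Once the past is factored out, the cone contributes an expectation on its own survival event.
    The bound on it is unnormalised, with [rho] on the right instead of a division by it, so that
    the same factor reassembles the probability of the first cut. *)
Lemma esp_first_cut_le (R : realType) (p : R) (p0 : 0 <= p) (p1 : p <= 1)
  (B : set int) (W n : nat) (ts : seq nat) (t : nat) (y : int) (G : config -> R) (e : R) :
  (forall x, B x -> evenz x) -> (forall x, B x -> - W%:Z <= x <= W%:Z) ->
  (t <= n)%N -> dep (cone 0 0 (n - t)) G ->
  esp p (box (n - t) (n - t)) (fun w => ind (alive cfg_coord (n - t) w) * G w) <= e * rho p (n - t) ->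
  esp p (box (W + n.*2) n) (fun w => ind (first_cut B n ts t y w) * G (translate y t w)) <=
  esp p (box (W + n.*2) n) (fun w => ind (first_cut B n ts t y w) * e).
Proof.
move=> evenB BW tn dG hG; set s := box _ _; set m := (n - t)%N.
have BW' x : B x -> x <= W%:Z by move=> /BW; lia.
(* Other values of [y] are out of reach from [B]. For these values the cone spreads by at most [n]
   more, which explains the width W + 2n of the box. *)
case: (pselect (- (W + n)%:Z <= y <= (W + n)%:Z)) => [hy|hy]; last first.
  apply: esp_le => // w; rewrite ind_false ?mul0r // => -[g [[Bg og _] gt _ _]]; apply: hy.
  have := @opath_drift _ _ _ _ 0%N t og ltac:(lia) tn.
  by have := BW _ Bg; rewrite gt; lia.
have ecut w : ind (first_cut B n ts t y w) =
    ind (cut_past B n ts t y w) * ind (alive cfg_coord m (translate y t w)) :> R.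
  rewrite -ind_and; apply: ind_eq; rewrite (first_cutE ts evenB BW' _ _ tn).
  by rewrite (alive_shift y t (n - t) w).
have dcut : dep (~` cone y t m) (fun w => ind (cut_past B n ts t y w) : R).
  exact/dep_ind/cut_past_dep.
have key (H : config -> R) : dep (cone 0 0 m) H ->
    esp p s (fun w => ind (first_cut B n ts t y w) * H (translate y t w)) =
    esp p s (fun w => ind (cut_past B n ts t y w)) *
    esp p (box m m) (fun w => ind (alive cfg_coord m w) * H w).
  move=> dH; pose H' w := ind (alive cfg_coord m w) * H w.
  have dH' : dep (cone 0 0 m) H'.
    by move=> w w' ww'; rewrite /H' (dH _ _ ww') (alive_dep ww').
  rewrite -(@esp_shift _ _ s y t m H').
  - rewrite -(@esp_indep _ p s (~` cone y t m) (cone y t m)) //.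
      by apply: esp_ext => w; rewrite ecut mulrA.
    by move=> w w' ww'; apply: dH'; exact: shift_cone.
  - exact: uniq_box.
  - exact: dep_sub (@cone_box m) dH'.
  - move=> _ /mapP[[[x u] b] + ->]; rewrite /shift_bond /= !mem_box => h.
    by move: hy; rewrite /m in h; lia.
rewrite (key _ dG) (key (fun=> e)) //; apply: ler_wpM2l.
  by apply: esp_ge0 => // w; exact: ind_ge0.
apply: le_trans hG _; rewrite le_eqVlt; apply/orP; left; apply/eqP.
by rewrite -/m /rho /prob -espZ; apply: esp_ext => w; rewrite mulrC.
Qed.

(** * Comparison of a finite start with the conditioned process *)

Section finite_start.
Context {R : realType} (p : R) (p0 : 0 <= p) (p1 : p <= 1).
Variable r : nat -> R.
Variable d : R.
Hypothesis r_dual : forall s z t k, uniq s -> (k <= t)%N -> prob p s (dual_alive z t k) <= r k.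
Hypothesis r_le1 : forall k, r k <= 1.
Hypothesis r_prod : forall L, d <= \prod_(k <- iota 1 L) (1 - r k).
Hypothesis d_le1 : d <= 1.
Variables (B : set int) (W n L J K : nat).
Hypothesis evenB : forall x, B x -> evenz x.
Hypothesis BW : forall x, B x -> - W%:Z <= x <= W%:Z.
Hypothesis JLn : (2 * (J * L) <= n)%N.
Variables (f : cantor_space -> R) (l C e1 e2 : R).
Hypothesis f_bound : forall a, `|f a - l| <= C.
Hypothesis f_unif : forall a b : cantor_space, (forall k, (k < K)%N -> a k = b k) -> `|f a - f b| <= e1.
Hypothesis f_cond : forall m, (J * L <= m)%N ->
  esp p (box m m) (fun w => ind (alive cfg_coord m w) * (f (zeta_ind cfg_coord [set 0] m w) - l)) <=
  e2 * rho p m.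
Hypothesis e1_ge0 : 0 <= e1.
Hypothesis e2_ge0 : 0 <= e2.

Let s := box (W + n.*2) n.
Let ts := [seq (n - 2 * (J * L) + j.+1 * L)%N | j <- iota 0 J].

Let JL_le : (J * L <= n)%N. Proof. by lia. Qed.

Let ts_le t : t \in ts -> (t <= n - J * L)%N.
Proof.
move=> /mapP[j]; rewrite mem_iota => /andP[_ jJ] ->.
have : (j.+1 * L <= J * L)%N by rewrite leq_mul2r; lia.
by lia.
Qed.

Let cut_dec w : option (nat * int) :=
  match pselect (exists2 ty : nat * int, ty.1 \in ts & first_cut B n ts ty.1 ty.2 w) with
  | left h => Some (projT1 (cid2 h))
  | right _ => None
  end.

Let cut_decP w t y : cut_dec w = Some (t, y) <-> t \in ts /\ first_cut B n ts t y w.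
Proof.
rewrite /cut_dec; case: pselect => [h|h]; last first.
  by split=> // -[h1 h2]; exfalso; apply: h; exists (t, y).
case: (cid2 h) => -[t' y'] /= h1 h2; split=> [[<- <-] //|[h3 h4]]; congr Some.
have tsn i : i \in ts -> (i <= n)%N by move=> /ts_le; lia.
by have [-> ->] := first_cut_uniq tsn h1 h3 h2 h4.
Qed.

(** The centred value of [f] for the process restarted at the first cut. The default 0 in the
    absence of a cut does not spoil the bound [e2] on its mean. *)
Let renewed w : R :=
  if cut_dec w is Some (t, y) then
    f (zeta_ind cfg_coord [set 0] (n - t) (translate y t w)) - l else 0.

Let C_ge0 : 0 <= C. Proof. exact: le_trans (normr_ge0 _) (f_bound (fun=> false)). Qed.

Let renewed_le : esp p s renewed <= e2.
Proof.
rewrite -[leRHS](esp_cst p s e2).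
apply: (esp_cond_le (v := cut_dec)) => -[[t y]|]; last first.
  apply: esp_le => // w; case: (pselect (cut_dec w = None)) => h; last by rewrite ind_false // !mul0r.
  by rewrite (ind_true h) !mul1r /renewed h.
case: (boolP (t \in ts)) => tts; last first.
  apply: esp_le => // w; rewrite ind_false ?mul0r // => /cut_decP[h _].
  by rewrite h in tts.
have e w : ind (cut_dec w = Some (t, y)) = ind (first_cut B n ts t y w) :> R.
  by apply: ind_eq; rewrite cut_decP; split=> [[]|].
have tn := ts_le tts.
have tn' : (t <= n)%N by lia.
have mJL : (J * L <= n - t)%N by lia.
pose G w := f (zeta_ind cfg_coord [set 0] (n - t) w) - l.
have dG : dep (cone 0 0 (n - t)) G by move=> w w' ww'; rewrite /G (zeta_ind_dep ww').
have := @esp_first_cut_le _ _ p0 p1 B W n ts t y G e2 evenB BW tn' dG (f_cond mJL).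
rewrite -/s => h; apply: le_trans (le_trans h _).
  rewrite le_eqVlt; apply/orP; left; apply/eqP; apply: esp_ext => w.
  case: (pselect (cut_dec w = Some (t, y))) => h1.
    by rewrite -e (ind_true h1) !mul1r /renewed h1.
  by rewrite -e ind_false // !mul0r.
by rewrite le_eqVlt; apply/orP; left; apply/eqP; apply: esp_ext => w; rewrite e.
Qed.

Let no_cut w := exists2 g, rmost w B n g /\ (forall u, (n < u)%N -> g u = 0) &
  forall i, i \in ts -> ~ cut_at B n g i w.

Let intruder w := exists2 g, rmost w B n g /\ (forall u, (n < u)%N -> g u = 0) &
  left_intruder K (J * L) n g w.

Let eta := (1 - d) ^+ J + J%:R * ((4 * (J * L))%:R * rdual p L).

Let prob_no_cut : prob p s no_cut <= eta.
Proof.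
have d0 : 0 <= 1 - d by rewrite subr_ge0.
apply: prob_rmost_cond => // [|g].
  apply: addr_ge0; first exact: exprn_ge0.
  by apply: mulr_ge0 => //; apply: mulr_ge0 => //; exact: rdual_ge0.
have tsn i : i \in ts -> (i <= n)%N by move=> /ts_le; lia.
apply: le_trans (@prob_rmost_no_cut _ p p0 p1 B n g evenB s ts tsn) _.
case: (pselect (walk g n)) => wg.
  apply: ler_wpM2l; first exact: prob_ge0.
  exact: (@prob_all_obstructed _ p p0 p1 B n g r d r_dual r_le1 r_prod d_le1 s L J (uniq_box _ _) wg JLn).
have -> : prob p s (fun w => rmost w B n g) = 0.
  rewrite -(prob_false p s); apply: prob_eq => w; split=> // -[_ h _].
  by apply: wg; exact: opath_walk h.
by rewrite !mul0r.
Qed.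

Let prob_intruder : prob p s intruder <= K%:R * rdual p (J * L).
Proof.
apply: prob_rmost_cond => // [|g]; first by apply: mulr_ge0 => //; exact: rdual_ge0.
by apply: prob_rmost_intruder => //; exact: uniq_box.
Qed.

(** Three bad events are paid for by the bound [C]: extinction, absence of a cut, an intruder from
    the left. Off these, the first [K] coordinates agree with those of the restarted process. The
    estimate is one-sided; the other side comes from applying it to - f. *)
Lemma esp_zeta_le :
  esp p s (fun w => f (zeta_ind cfg_coord B n w) - l) <=
  C * prob p s (fun w => ~ exists q, B (q 0%N) /\ opath w q 0 n) +
  C * ((1 - d) ^+ J + J%:R * ((4 * (J * L))%:R * rdual p L)) +
  2 * C * (K%:R * rdual p (J * L)) + e1 + e2.
Proof.
rewrite -/eta; pose dead (w : config) := ~ exists q, B (q 0%N) /\ opath w q 0 n.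
rewrite -[X in C * X + _ + _ + _ + _]/(prob p s dead).
apply: (@le_trans _ _ (C * prob p s dead + C * prob p s no_cut + 2 * C * prob p s intruder + e1 +
  esp p s renewed)); last first.
  by apply: lerD renewed_le; rewrite lerD2r; apply: lerD; rewrite ?lerD2l; apply: ler_wpM2l;
    rewrite ?mulr_ge0.
rewrite /prob -!espZ -(esp_cst p s e1) -!espD; apply: esp_le => // w.
have fC a : f a - l <= C by exact: le_trans (ler_norm _) (f_bound a).
have Cf a : - C <= f a - l by rewrite lerNl; apply: le_trans (f_bound a); rewrite -normrN ler_norm.
have h1 : 0 <= e1 by exact: e1_ge0.
have Ci Q : 0 <= C * ind Q by rewrite mulr_ge0 ?ind_ge0.
have Ci1 := Ci (dead w); have Ci2 := Ci (no_cut w); have Ci3 := Ci (intruder w).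
have fw := fC (zeta_ind cfg_coord B n w).
case E : (cut_dec w) => [[t y]|]; last first.
  have -> : renewed w = 0 by rewrite /renewed E.
  case: (pselect (dead w)) => hd; first by rewrite (ind_true hd); lra.
  have [q [Bq oq]] := contrapT hd.
  have BW' x : B x -> x <= W%:Z by move=> /BW /andP[].
  have [g rg g0] := rmost_exists evenB BW' Bq oq.
  suff h : no_cut w by rewrite (ind_true h); lra.
  exists g => // i its ci.
  have [|t tts fc] := @exists_first_cut B n ts w g rg; first by exists i.
  by have /cut_decP : t \in ts /\ first_cut B n ts t (g t) w by []; rewrite E.
have /cut_decP[tts [g [rg gt _ _]]] := E.
have -> : renewed w = f (zeta_ind cfg_coord [set 0] (n - t) (translate y t w)) - l.
  by rewrite /renewed E.
set b := zeta_ind _ _ _ (translate _ _ _).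
(* This event costs 2C because a cut exists here: the left side is at most [C], while the restarted
   value on the right may be as low as - C. *)
case: (pselect (intruder w)) => hi.
  by rewrite (ind_true hi); have := Cf b; lra.
have : `|f (zeta_ind cfg_coord B n w) - f b| <= e1.
  apply: f_unif => k kK; rewrite /b -gt; apply: (@zeta_ind_cut w B n g K (J * L)) => //.
  - exact: ts_le.
  - move=> hl; apply: hi.
    pose g' u := if (u <= n)%N then g u else 0.
    have gg' u : (u <= n)%N -> g u = g' u by move=> un; rewrite /g' un.
    exists g'; first by split; [exact: rmost_ext gg' rg|move=> u; rewrite /g' ltnNge => /negbTE ->].
    case: hl => i iK [q [k1 k2 k3]]; exists i => //; exists q; split=> //.
      by rewrite -gg'.
    by move=> u ub; rewrite -gg'; [exact: k3|case/andP: ub].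
by move=> /(le_trans (ler_norm _)); lra.
Qed.

End finite_start.

(** * Sharpness of the phase transition *)

Definition src (e : bond) : int * nat := e.1.
Definition tgt (e : bond) : int * nat := (if e.2 then e.1.1 + 1 else e.1.1 - 1, e.1.2.+1).

Definition reach_in (S : set (int * nat)) (z : int * nat) (w : config) : Prop :=
  exists q, [/\ q 0%N = 0, q z.2 = z.1, opath w q 0 z.2 &
    forall u, (u <= z.2)%N -> S (q u, u)].

Definition dead_sites (n : nat) (w : config) : set (int * nat) :=
  [set z | (z.2 <= n)%N /\ ~ exists q, q z.2 = z.1 /\ opath w q z.2 n].

Definition influence {R : realType} (e : bond) (F : config -> R) (w : config) : R :=
  F (upd w e true) - F (upd w e false).

(* Up to a factor p, the functional of Duminil-Copin and Tassion *)
Definition exit_sum {R : realType} (p : R) (n : nat) (S : set (int * nat)) : R :=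
  \sum_(e <- box n n) ind (~ S (tgt e)) * prob p (box n n) (reach_in S (src e)).

Lemma upd_upd w e b b' : upd (upd w e b) e b' = upd w e b'.
Proof. by apply: funext => x; rewrite /upd; case: (x == e). Qed.

Section russo.
Context {R : realType}.
Implicit Types (p q : R) (F : config -> R).

Lemma esp_nondecr_p p q s F : 0 <= p -> p <= q -> q <= 1 -> nondecr F -> esp p s F <= esp q s F.
Proof.
move=> p0 pq q1; elim: s F => [|e s IH] F hF //=.
have h1 := IH _ (nondecr_upd e true hF); have h0 := IH _ (nondecr_upd e false hF).
have h : esp q s (fun w => F (upd w e false)) <= esp q s (fun w => F (upd w e true)).
  by apply: esp_le; [lra|lra|] => w; exact: nondecr_updFT.
move: h1 h0 h; set a1 := esp p _ _; set a0 := esp p _ _; set b1 := esp q _ _; set b0 := esp q _ _.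
move=> h1 h0 h.
have k1 : 0 <= p * (b1 - a1) by rewrite mulr_ge0 // subr_ge0.
have k2 : 0 <= (1 - p) * (b0 - a0) by rewrite mulr_ge0 // subr_ge0 //; lra.
have k3 : 0 <= (q - p) * (b1 - b0) by rewrite mulr_ge0 // subr_ge0.
by lra.
Qed.

Lemma russo p s F : uniq s ->
  is_derive p 1 (fun x => esp x s F) (\sum_(e <- s) esp p s (influence e F)).
Proof.
elim: s F => [|e s IH] F /=.
  move=> _; rewrite big_nil; exact: is_derive_cst.
move=> /andP[es us].
have h1 := IH (fun w => F (upd w e true)) us; have h0 := IH (fun w => F (upd w e false)) us.
apply: is_derive_eq.
rewrite big_cons /= big_split /= -!mulr_sumr.
have E0 b : esp p s (fun w => influence e F (upd w e b)) =
    esp p s (fun w => F (upd w e true)) - esp p s (fun w => F (upd w e false)).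
  by rewrite -espB; apply: esp_ext => w; rewrite /influence !upd_upd.
have E b : \sum_(e' <- s) esp p s (fun w => influence e' F (upd w e b)) =
    \sum_(e' <- s) esp p s (influence e' (fun w => F (upd w e b))).
  apply: eq_big_seq => e' e's; apply: esp_ext => w; rewrite /influence.
  have ne : e != e' by apply: contraNneq es => ->.
  by rewrite !(updC w b _ ne).
by rewrite !E0 !E /GRing.scale /=; ring.
Qed.

(** The mean value theorem together with monotonicity in the parameter replaces the integration of
    the differential inequality for [rho]. *)
Lemma rho_mvt p q n c : 0 <= p -> p < q -> q <= 1 -> 0 <= c ->
  (forall x, p <= x -> x <= q ->
    c * (1 - rho x n) <= \sum_(e <- box n n) esp x (box n n) (influence e (fun w => ind (alive cfg_coord n w)))) ->
  c * (q - p) * (1 - rho q n) <= rho q n.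
Proof.
move=> p0 pq q1 c0 h.
have der x := russo x (fun w => ind (alive cfg_coord n w) : R) (uniq_box n n).
have cont : {within `[p, q], continuous (fun x => esp x (box n n) (fun w => ind (alive cfg_coord n w) : R))}.
  apply: derivable_within_continuous => x _; exact: (@ex_derive _ _ _ _ _ _ _ (der x)).
have [x /[!in_itv]/= /andP[px xq] e] := MVT pq (fun x _ => der x) cont.
have hx := h x (ltW px) (ltW xq).
have iA : nondecr (fun w => ind (alive cfg_coord n w) : R).
  by apply: incr_nondecr => w w' ww' /alive_path [r [h1 h2]]; apply/alive_path; exists r; split=> //; exact: opath_mono h2.
have mono : rho x n <= rho q n by apply: esp_nondecr_p => //; lra.
have r0 : 0 <= rho p n by apply: rho_ge0; lra.
move: e; rewrite -!/(prob _ _ _) -!/(rho _ _) => e.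
have k1 : c * (1 - rho q n) <= c * (1 - rho x n) by apply: ler_wpM2l => //; lra.
have k2 : c * (1 - rho q n) * (q - p) <=
  (\sum_(e <- box n n) esp x (box n n) (influence e (fun w => ind (alive cfg_coord n w)))) * (q - p).
  by apply: ler_wpM2r; lra.
by lra.
Qed.

End russo.

Lemma step_bond w x u y : step w x u y -> exists b, w (x, u, b) /\ tgt (x, u, b) = (y, u.+1).
Proof. by case=> -[-> h]; [exists true|exists false]. Qed.

Lemma bond_step (w : config) e x u y : w e -> src e = (x, u) -> tgt e = (y, u.+1) -> step w x u y.
Proof.
by case: e => -[x' u'] [] /= h [] ex eu; rewrite /tgt /= ex eu => -[<-]; [left|right]; rewrite -ex -eu.
Qed.

Lemma opath_bonds (w w' : config) q a b : (forall e u, (a <= u < b)%N -> src e = (q u, u) ->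
    tgt e = (q u.+1, u.+1) -> w e -> w' e) -> opath w q a b -> opath w' q a b.
Proof.
move=> h o u ub; have [d [h1 h2]] := step_bond (o u ub).
by apply: (@bond_step w' (q u, u, d)) => //; apply: (h _ u).
Qed.

Lemma reach_in_dep S z : dep [set e | S (src e) /\ S (tgt e)] (reach_in S z).
Proof.
apply: dep_prop => w w' ww' [q [q0 qz o h]]; exists q; split=> //.
apply: (opath_bonds _ o) => e u ub s t; rewrite ww' //=; rewrite s t; split; apply: h; lia.
Qed.

Lemma reach_in_incr S z : incr (reach_in S z).
Proof. by move=> w w' ww' [q [q0 qz o h]]; exists q; split=> //; exact: opath_mono o. Qed.

(** The dead set is found by exploring backwards from level [n]; this exploration never inspects a
    bond with both ends in the dead set. *)
Lemma dead_sites_dep n (c : set (int * nat)) :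
  dep [set e | ~ (c (src e) /\ c (tgt e))] (fun w => dead_sites n w = c).
Proof.
have half w w' : (forall e, ~ (c (src e) /\ c (tgt e)) -> w e = w' e) -> dead_sites n w = c ->
    dead_sites n w' = c.
  move=> ww' dc; subst c; apply/seteqP; split=> -[x u] /=.
    move=> [un nq]; split=> //; case=> q [/= qu o]; apply: nq; exists q; split=> //.
    apply: (opath_bonds _ o) => e v ub s t we; rewrite -ww' // => -[].
    rewrite t => _ [_]; apply; exists q; split=> //=.
    by apply: opath_sub o; lia.
  move=> [un nq]; split=> //; case=> q [/= qu o]; apply: nq.
  (* Downward induction from level [n]: a site of the path of [w'] that is live for [w] is entered
     by a bond with an end outside the dead set, and such a bond has the same state in both
     configurations. *)
  have D v : (v <= n - u)%N -> exists q', q' (n - v)%N = q (n - v)%N /\ opath w q' (n - v) n.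
    elim: v => [_|v IH vn].
      by exists q; rewrite subn0; split=> // i; lia.
    have [q' [q'e q'o]] := IH ltac:(lia).
    have ev : (n - v = (n - v.+1).+1)%N by lia.
    have st : step w' (q (n - v.+1)%N) (n - v.+1) (q (n - v)%N).
      by rewrite [in q (n - v)%N]ev; apply: o; lia.
    have [d [h1 h2]] := step_bond st.
    exists (join_at (n - v.+1) q q'); rewrite join_atL //; split=> //.
    have nc : ~ dead_sites n w (q (n - v)%N, (n - v)%N).
      by case=> _; apply; exists q'.
    have h3 : w (q (n - v.+1)%N, (n - v.+1)%N, d).
      by rewrite ww' // h2 -ev => -[_].
    move=> i ib; case: (eqVneq i (n - v.+1)%N) => [->|ne].
      rewrite join_atL // /join_at ltnn -ev q'e.
      by apply: (bond_step h3) => //; rewrite h2.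
    rewrite /join_at; have -> : (i <= n - v.+1)%N = false by lia.
    have -> : (i < n - v.+1)%N = false by lia.
    by apply: q'o; lia.
  have [q' [h1 h2]] := D (n - u)%N (leqnn _); rewrite subKn // in h1 h2.
  by exists q'; rewrite h1.
by apply: dep_prop => w w'; exact: half.
Qed.

Lemma dead_sites_level n w x u : dead_sites n w (x, u) -> (u < n)%N.
Proof.
move=> [/= un nq]; rewrite ltn_neqAle un andbT; apply/eqP => e; apply: nq.
by exists (fun=> x); split=> // v; rewrite e; lia.
Qed.

Lemma not_dead_origin n w : ~ dead_sites n w (0, 0%N) <-> alive cfg_coord n w.
Proof.
rewrite alive_path; split=> [h|[q [q0 o]] [_]]; last by apply; exists q.
by apply: contrapT => nq; apply: h; split=> // -[q /= [q0 o]]; apply: nq; exists q.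
Qed.

Section sharpness.
Context {R : realType}.

Lemma exit_sum_ge0 (p : R) n S : 0 <= p -> p <= 1 -> 0 <= exit_sum p n S.
Proof. by move=> p0 p1; apply: sumr_ge0 => e _; rewrite mulr_ge0 ?ind_ge0 ?prob_ge0. Qed.

Lemma exit_sum_mono (p q : R) n S : 0 <= p -> p <= q -> q <= 1 -> exit_sum p n S <= exit_sum q n S.
Proof.
move=> p0 pq q1; apply: ler_sum => e _; apply: ler_wpM2l; first exact: ind_ge0.
by apply: esp_nondecr_p => //; exact/incr_nondecr/reach_in_incr.
Qed.

Lemma alive_incr n : incr (alive cfg_coord n).
Proof.
move=> w w' ww' /alive_path [r [h1 h2]]; apply/alive_path; exists r; split=> //.
exact: opath_mono h2.
Qed.

(* A bond leading from the cluster of 0 inside the set of dead sites to a live site is pivotal. *)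
Lemma influence_ge (p : R) n : 0 <= p -> p <= 1 ->
  (forall S : set (int * nat), S (0, 0%N) -> (forall x u, S (x, u) -> (u < n)%N) -> 1 <= exit_sum p n S) ->
  1 - rho p n <= \sum_(e <- box n n) esp p (box n n) (influence e (fun w => ind (alive cfg_coord n w))).
Proof.
move=> p0 p1 h; set s := box n n.
pose piv e w := ~ dead_sites n w (tgt e) /\ reach_in (dead_sites n w) (src e) w.
apply: (@le_trans _ _ (esp p s (fun w => \sum_(e <- s) ind (piv e w)))); last first.
  rewrite esp_sum big_seq [leRHS]big_seq; apply: ler_sum => -[[x u] d] es; apply: esp_le => // w.
  have := nondecr_updFT (x, u, d) w (incr_nondecr (R := R) (@alive_incr n)).
  case: (pselect (piv (x, u, d) w)) => [[nt [q [q0 qx o hS]]]|np]; last first.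
    by rewrite (ind_false np) /influence subr_ge0.
  move=> _; apply: le_trans (ind_le1 _) _; rewrite /influence ind_true; last first.
    apply/alive_path; have un : (u < n)%N by move: es; rewrite mem_box => /andP[].
    have [q' [q'e o']] : exists q', q' u.+1 = (tgt (x, u, d)).1 /\ opath w q' u.+1 n.
      by apply: contrapT => nq; apply: nt; split=> //=; lia.
    exists (join_at u q q'); split; first by rewrite join_atL.
    apply: (@opath_cat _ _ _ u).
      apply: (@opath_mono w); first by move=> e; rewrite /upd; case: ifP.
      by apply: opath_ext o => v vb; rewrite join_atL //; lia.
    move=> v vb; case: (eqVneq v u) => [->|ne].
      rewrite join_atL // /join_at ltnn q'e qx.
      by apply: (@bond_step _ (x, u, d)) => //; exact: upd_same.
    rewrite /join_at; have -> : (v <= u)%N = false by lia.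
    have -> : (v < u)%N = false by lia.
    apply: (@step_mono w); first by move=> e; rewrite /upd; case: ifP.
    by apply: o'; lia.
  rewrite ind_false ?subr0 // => ha.
  have : alive cfg_coord n w.
    by apply: alive_incr ha => e; rewrite /upd; case: ifP.
  by move=> /not_dead_origin; apply; rewrite -q0; exact: (hS 0%N).
rewrite /rho -prob_not // -/s.
apply: (esp_cond_le (v := dead_sites n)) => // c.
case: (pselect (exists w, dead_sites n w = c)) => [[w0 ew0]|nw]; last first.
  by apply: esp_le => // w; rewrite ind_false ?mul0r // => e; apply: nw; exists w.
case: (pselect (c (0, 0%N))) => c0; last first.
  apply: esp_le => // w; case: (pselect (dead_sites n w = c)) => e; last by rewrite ind_false // !mul0r.
  rewrite (ind_true e) !mul1r ind_false ?sumr_ge0 //.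
  by apply; apply/not_dead_origin; rewrite e.
apply: (@le_trans _ _ (esp p s (fun w => ind (dead_sites n w = c)) * exit_sum p n c)).
  rewrite -[leLHS]mulr1; apply: ler_pM => //.
  - by apply: esp_ge0 => // w; rewrite mulr_ge0 // ind_ge0.
  - by apply: esp_le => // w; rewrite -[leRHS]mulr1; apply: ler_wpM2l; [exact: ind_ge0|exact: ind_le1].
  - by apply: h => // x u; rewrite -ew0; exact: dead_sites_level.
rewrite /exit_sum mulr_sumr -/s.
have -> : esp p s (fun w => ind (dead_sites n w = c) * \sum_(e <- s) ind (piv e w)) =
    \sum_(e <- s) esp p s (fun w => ind (dead_sites n w = c) * ind (piv e w)).
  by rewrite -esp_sum; apply: esp_ext => w; rewrite mulr_sumr.
apply: ler_sum => e _; rewrite mulrCA.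
(* Given that the dead set is [c], the bonds inside [c] are fresh, and reaching the source of [e]
   inside [c] depends on them alone. *)
rewrite -(esp_indep p s (dep_ind (@dead_sites_dep n c)) (dep_ind (@reach_in_dep c (src e)))); last first.
  by move=> e'.
rewrite -espZ; apply: esp_le => // w.
case: (pselect (dead_sites n w = c)) => ec; last by rewrite (ind_false ec) !mul0r mulr0.
by rewrite (ind_true ec) !mul1r -ind_and; apply: ind_le; rewrite /piv ec.
Qed.

End sharpness.

(** * Contraction of the survival probability by a finite set with small exit sum *)

Definition cluster_in (S : set (int * nat)) (w : config) : set (int * nat) :=
  [set z | reach_in S z w].

Definition alive_off (c : set (int * nat)) (z : int * nat) (n : nat) (w : config) : Prop :=
  exists q, [/\ q z.2 = z.1, opath w q z.2 n & forall u, (z.2 <= u <= n)%N -> ~ c (q u, u)].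

(** Exploring the cluster of the origin inside [S] inspects only bonds that start in the cluster and
    end in [S]. *)
Lemma cluster_in_dep (S c : set (int * nat)) : S (0, 0%N) ->
  dep [set e | c (src e) /\ S (tgt e)] (fun w => cluster_in S w = c).
Proof.
move=> S0; apply: dep_prop => w w' ww' dc; subst c.
have origin v : cluster_in S v (0, 0%N).
  by exists (fun=> 0); split=> //= u; rewrite leqn0 => /eqP ->.
apply/seteqP; split=> -[x u] [q [/= q0 qx o h]].
  suff C v : (v <= u)%N -> cluster_in S w (q v, v) by rewrite -qx; exact: C.
  elim: v => [|v IH] vu; first by rewrite q0; exact: origin.
  have cv := IH ltac:(lia); have [q' [/= q'0 q'v o' h']] := cv.
  have [d [h1 h2]] := step_bond (o v ltac:(lia)).
  have h3 : w (q v, v, d) by rewrite ww' //= h2; split=> //; exact: h.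
  exists (join_at v q' q); split=> /=.
  - by rewrite join_atL.
  - by rewrite join_atR.
  - apply: opath_join => // i ib; have -> : i = v by lia.
    exact: (bond_step h3).
  - move=> i; rewrite leq_eqVlt => /orP[/eqP ->|iv]; first by rewrite join_atR //; exact: h.
    by rewrite join_atL //; apply: h'; lia.
exists q; split=> //.
apply: (opath_bonds _ o) => e v vb s t we; rewrite -ww' //= s t; split; last by apply: h; lia.
exists q; split=> //=; first by apply: opath_sub o; lia.
by move=> i iv; apply: h; lia.
Qed.

Section growth.
Context {R : realType} (p : R) (p0 : 0 <= p) (p1 : p <= 1).

Lemma rho_antitone m k : rho p (m + k) <= rho p m.
Proof.
apply: le_trans (prob_alive_from p0 p1 0 0 m (uniq_box (m + k) (m + k))).
apply: prob_le => // w /alive_path [q [q0 o]]; exists q; split=> //.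
by apply: opath_sub o; lia.
Qed.

Lemma prob_open e s : e \in s -> uniq s -> prob p s (fun w => w e) = p.
Proof.
move=> es us; rewrite /prob (esp_single (e := e) p es us); last by move=> w w' /(_ e erefl) ->.
by rewrite ind_true // ind_false //; ring.
Qed.

(* The last point of a surviving path in the cluster of 0 inside S sits at an exit bond of S;
   the rest of the path avoids this cluster. *)
Lemma growth h S n : S (0, 0%N) -> (forall x u, S (x, u) -> (u < h)%N) ->
  rho p (n + h) <= p * exit_sum p h S * rho p n.
Proof.
move=> S0 Sh; set s := box (n + h) (n + h); have us : uniq s := uniq_box _ _.
pose leak (e : bond) w := cluster_in S w (src e) /\ ~ S (tgt e).
apply: (@le_trans _ _ (esp p s (fun w => \sum_(e <- box h h) ind (leak e w) * (p * rho p n)))); last first.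
  rewrite esp_sum /exit_sum mulr_sumr mulr_suml big_seq [leRHS]big_seq; apply: ler_sum => e eh.
  have -> : prob p (box h h) (reach_in S (src e)) = prob p s (reach_in S (src e)).
    pose D := [pred e' : bond | e' \in box h h].
    have mono e' : e' \in box h h -> e' \in s.
      by case: e' => -[x u] b; rewrite !mem_box; lia.
    apply: (esp_irrel p (D := D)) (uniq_box _ _) us _; last first.
      by move=> e' /= he'; rewrite he' mono.
    apply: dep_ind; apply: dep_prop => w w' ww' [q [q0 qe o hS]]; exists q; split=> //.
    refine (opath_dep (D := [set e' | D e']) ww' _ o) => u d ub.
    have ueh : (u < h)%N by case: e eh ub {qe hS o} => -[x v] b; rewrite mem_box /=; lia.
    have := @opath_drift _ _ _ _ 0%N u o ltac:(lia) ltac:(lia).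
    by rewrite /= mem_box q0; lia.
  have -> : p * (ind (~ S (tgt e)) * prob p s (reach_in S (src e))) * rho p n =
    (ind (~ S (tgt e)) * (p * rho p n)) * prob p s (reach_in S (src e)) by ring.
  rewrite /prob -espZ; apply: esp_le => // w.
  by rewrite /leak ind_and le_eqVlt; apply/orP; left; apply/eqP; ring.
apply: (esp_cond_le (v := cluster_in S)) => // c.
case: (pselect (exists w, cluster_in S w = c)) => [[w0 ew0]|nw]; last first.
  by apply: esp_le => // w; rewrite ind_false ?mul0r // => e; apply: nw; exists w.
have c0 : c (0, 0%N).
  rewrite -ew0; exists (fun=> 0); split=> //= u; rewrite leqn0 => /eqP -> //.
have cS z : c z -> S z.
  by rewrite -ew0; case: z => x u [q [_ /= <- _ hS]]; exact: hS.
pose way e w := [/\ cluster_in S w = c, c (src e) /\ ~ S (tgt e), w e & alive_off c (tgt e) (n + h) w].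
apply: (@le_trans _ _ (esp p s (fun w => \sum_(e <- box h h) ind (way e w)))).
  apply: esp_le => // w; rewrite -ind_and.
  case: (pselect (cluster_in S w = c /\ alive cfg_coord (n + h) w)) => [[ec /alive_path [q [q0 o]]]|nn]; last first.
    by rewrite (ind_false nn) sumr_ge0.
  have exu : exists u, `[< c (q u, u) >] by exists 0%N; apply/asboolP; rewrite q0.
  have bnd u : `[< c (q u, u) >] -> (u <= h)%N by move=> /asboolP /cS /Sh; lia.
  have [u /asboolP cu umax] := ex_maxnP exu bnd.
  have uh := Sh _ _ (cS _ cu).
  have [d [we te]] := step_bond (o u ltac:(lia)).
  have eb : (q u, u, d) \in box h h.
    have := @opath_drift _ _ _ _ 0%N u o ltac:(lia) ltac:(lia).
    by rewrite mem_box q0; lia.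
  have nc v : (u < v)%N -> ~ c (q v, v).
    by move=> uv cv; have := umax v (asboolT cv); lia.
  apply: le_trans (ind_le1 _) _; rewrite (bigD1_seq (q u, u, d)) ?uniq_box //= ind_true ?lerDl ?sumr_ge0 //.
  split=> //.
    split=> // ht; apply: (nc u.+1) => //; rewrite -ec.
    have : cluster_in S w (q u, u) by rewrite ec.
    move=> [q' [/= q'0 q'u o' hS']]; exists (join_at u q' q); split=> /=.
    - by rewrite join_atL.
    - by rewrite join_atR.
    - apply: opath_join => // i ib; have -> : i = u by lia.
      by apply: o; lia.
    - move=> i; rewrite leq_eqVlt => /orP[/eqP ->|iv]; first by rewrite join_atR // -te.
      by rewrite join_atL //; apply: hS'; lia.
  exists q; rewrite te; split=> //; first by apply: opath_sub o; lia.
  by move=> v /= vb; apply: nc; lia.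
have -> : esp p s (fun w => ind (cluster_in S w = c) * \sum_(e <- box h h) ind (leak e w) * (p * rho p n)) =
    \sum_(e <- box h h) esp p s (fun w => ind (cluster_in S w = c) * (ind (leak e w) * (p * rho p n))).
  by rewrite -esp_sum; apply: esp_ext => w; rewrite mulr_sumr.
rewrite esp_sum big_seq [leRHS]big_seq; apply: ler_sum => e eh.
case: (pselect (c (src e) /\ ~ S (tgt e))) => [[ce nS]|nn]; last first.
  apply: esp_le => // w; rewrite ind_false; last by case.
  by rewrite !mulr_ge0 // rho_ge0.
have eu : (e.1.2 < h)%N by case: e eh {ce nS} => -[x v] b; rewrite mem_box /=; lia.
apply: (@le_trans _ _ (prob p s (fun w => cluster_in S w = c /\ (w e /\ alive_off c (tgt e) (n + h) w)))).
  by apply: prob_le => // w [? ? ? ?].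
(* The bonds explored, the exit bond [e] and the bonds starting off the cluster are pairwise
   disjoint sets, so the three events are independent. *)
rewrite (@prob_indep _ p s [set e' | c (src e') /\ S (tgt e')] [set e' | e' = e \/ ~ c (src e')]); first last.
- move=> e' /= [h1 h2] [h3|//]; by rewrite h3 in h2.
- apply: dep_and; first by move=> w w' ww'; rewrite ww' //; left.
  apply: dep_prop => w w' ww' [q [h1 h2 h3]]; exists q; split=> //.
  by apply: (opath_dep ww' _ h2) => u d ub; right; apply: h3; lia.
- exact: cluster_in_dep.
have -> : prob p s (fun w => w e /\ alive_off c (tgt e) (n + h) w) =
    p * prob p s (alive_off c (tgt e) (n + h)).
  have es : e \in s by case: e eh {ce nS eu} => -[x v] b; rewrite !mem_box; lia.
  rewrite (@prob_indep _ p s [set e] [set e' | ~ c (src e')]).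
  - by rewrite prob_open.
  - by move=> w w' ww'; rewrite ww'.
  - apply: dep_prop => w w' ww' [q [h1 h2 h3]]; exists q; split=> //.
    by apply: (opath_dep ww' _ h2) => u d ub; apply: h3; lia.
  - by move=> e' /= ->.
apply: (@le_trans _ _ (prob p s (fun w => cluster_in S w = c) * (p * rho p n))).
  apply: ler_wpM2l; first exact: prob_ge0.
  apply: ler_wpM2l => //.
  apply: le_trans (rho_antitone n (h - e.1.2.+1)).
  apply: le_trans (prob_alive_from p0 p1 (tgt e).1 e.1.2.+1 _ us).
  apply: prob_le => // w [q [h1 h2 _]]; exists q; split=> //.
  by have -> : (e.1.2.+1 + (n + (h - e.1.2.+1)) = n + h)%N by lia.
rewrite mulrC /prob -espZ; apply: esp_le => // w.
rewrite mulrC; case: (pselect (cluster_in S w = c)) => ec; last by rewrite (ind_false ec) !mul0r.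
by rewrite (ind_true ec) ind_true /leak ?ec // !mul1r.
Qed.

End growth.

(** If some finite-height [S] has p times its exit sum below 1, [growth] gives contraction.
    Otherwise every exit sum is at least 1 at [p], hence at each parameter in [p, q], and the
    influence bound with [rho_mvt] keeps [rho q] away from 0. *)
Lemma sharpness (R : realType) (p q : R) : 0 <= p -> p < q -> q <= 1 ->
  (exists h a, [/\ (0 < h)%N, 0 <= a, a < 1 & forall n, rho p (n + h) <= a * rho p n]) \/
  (forall n, (q - p) * (1 - rho q n) <= rho q n).
Proof.
move=> p0 pq q1; have p1 : p <= 1 by lra.
case: (pselect (exists h (S : set (int * nat)), [/\ S (0, 0%N), forall x u, S (x, u) -> (u < h)%N &
    p * exit_sum p h S < 1])) => [[h [S [S0 Sh lt1]]]|nS].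
  left; exists h, (p * exit_sum p h S); split=> //.
  - by have := Sh _ _ S0; lia.
  - by rewrite mulr_ge0 // exit_sum_ge0.
  - by move=> n; exact: growth.
right=> n.
have hS S : S (0, 0%N) -> (forall x u, S (x, u) -> (u < n)%N) -> 1 <= exit_sum p n S.
  move=> S0 Sn; apply: (@le_trans _ _ (p * exit_sum p n S)).
    by rewrite leNgt; apply/negP => h; apply: nS; exists n, S.
  by rewrite -[leRHS]mul1r; apply: ler_wpM2r => //; exact: exit_sum_ge0.
rewrite -[q - p]mul1r; apply: rho_mvt => // x px xq.
rewrite mul1r; apply: influence_ge; [by lra|by lra|] => S S0 Sn.
by apply: le_trans (hS S S0 Sn) _; apply: exit_sum_mono => //; lra.
Qed.

(** * Polynomial bounds and the constants of the excursion estimate *)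

Section decay.
Context {R : realType} (p : R) (p0 : 0 < p) (p1 : p < 1).

(** The smallest of the j + 1 terms of a geometric sum, times their number, is at most the sum. *)
Lemma linear_geometric (x : R) j : 0 <= x -> x < 1 -> (j.+1)%:R * x ^+ j * (1 - x) <= 1.
Proof.
move=> x0 x1; apply: (@le_trans _ _ ((1 - x ^+ j.+1))); last by rewrite gerBl exprn_ge0.
have -> : 1 - x ^+ j.+1 = (1 - x) * \sum_(i < j.+1) x ^+ i by rewrite -[LHS]opprB subrX1 -mulNr opprB.
rewrite mulrC; apply: ler_wpM2l; first by lra.
rewrite mulr_natl -[X in _ *+ X]card_ord -sumr_const; apply: ler_sum => i _.
by apply: ler_wiXn2l; [|exact: ltW|rewrite -ltnS].
Qed.

(** The decay is geometric, but a fixed power is enough. Of the exponent 4, one power is lost in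
    passing to [rdual]; the other three bring [rdual] below the summable (k + 1)^-2 without a
    constant for large [k], and make k times [rdual] vanish. The fourth root [x] of [a] turns the
    claim into a fourth power of [linear_geometric]. *)
Lemma rho_decay h a : (0 < h)%N -> 0 <= a -> a < 1 -> (forall n, rho p (n + h) <= a * rho p n) ->
  exists2 M, 0 <= M & forall k, (k.+1)%:R ^+ 4 * rho p k <= M.
Proof.
move=> h0 a0 a1 hr; pose x := Num.sqrt (Num.sqrt a).
have x0 : 0 <= x by exact: sqrtr_ge0.
have xa : x ^+ 4 = a by rewrite (exprM x 2 2) /x !sqr_sqrtr // sqrtr_ge0.
have x1 : x < 1 by rewrite -(@ltr_pXn2r _ 4) ?nnegrE // xa expr1n.
have p0' := ltW p0; have p1' := ltW p1.
have blocks j i : rho p (i + j * h) <= a ^+ j.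
  elim: j => [|j IH]; first by rewrite expr0; exact: prob_le1.
  rewrite mulSn [(h + _)%N]addnC addnA; apply: le_trans (hr _) _.
  by rewrite exprS; apply: ler_wpM2l.
have d0 : 0 < 1 - x by lra.
exists ((h%:R / (1 - x)) ^+ 4); first by rewrite exprn_ge0 // divr_ge0 // ltW.
move=> k; set j := (k %/ h)%N.
apply: (@le_trans _ _ ((h%:R * (j.+1)%:R) ^+ 4 * a ^+ j)).
  apply: ler_pM; rewrite ?exprn_ge0 ?rho_ge0 //.
    by rewrite lerXn2r ?nnegrE ?mulr_ge0 // -natrM ler_nat mulnC -ltn_divLR.
  by rewrite {1}(divn_eq k h) addnC; exact: blocks.
have -> : (h%:R * j.+1%:R) ^+ 4 * a ^+ j = (h%:R * (j.+1%:R * x ^+ j)) ^+ 4.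
  by rewrite -xa -exprM mulnC exprM -exprMn mulrA.
rewrite lerXn2r ?nnegrE ?mulr_ge0 ?exprn_ge0 ?invr_ge0 ?(ltW d0) //.
apply: ler_wpM2l => //; rewrite -[leRHS]mul1r ler_pdivlMr //; exact: linear_geometric.
Qed.

Lemma prob_open_le s e : uniq s -> prob p s (fun w => w e) <= p.
Proof.
move=> us; have p0' := ltW p0; have p1' := ltW p1.
case: (boolP (e \in s)) => es.
  rewrite /prob (esp_single (e := e) p es us); last by move=> w w' /(_ e erefl) ->.
  by rewrite ind_true // ind_false // mulr1 mulr0 addr0.
rewrite /prob (@esp_ext_in _ p s _ (fun=> 0)) ?esp_cst //.
by move=> w ws /=; rewrite (configs_closed ws es) ind_false.
Qed.

(** The dual cluster dies at once if both bonds entering (z, t) are closed. For small [k], where the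
    decay estimate may exceed 1, this is the bound that is strictly below 1. *)
Lemma prob_dual_alive_step s z t k : uniq s -> (0 < k <= t)%N ->
  prob p s (dual_alive z t k) <= 1 - (1 - p) ^+ 2.
Proof.
move=> us kt; have tt : (t - k <= t.-1 < t)%N by lia.
have t1 : t.-1.+1 = t by lia.
have p0' := ltW p0; have p1' := ltW p1.
pose e1 : bond := (z - 1, t.-1, true); pose e2 : bond := (z + 1, t.-1, false).
have i e : incr (fun w : config => w e) by move=> w w' h /h.
have := prob_harris_decr p0' p1' s (i e1) (i e2).
rewrite !prob_not => h.
have h1 := prob_open_le e1 us; have h2 := prob_open_le e2 us.
have h3 : (1 - p) ^+ 2 <= (1 - prob p s (fun w => w e1)) * (1 - prob p s (fun w => w e2)).
  by rewrite expr2; apply: ler_pM; lra.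
rewrite lerBrDr -lerBrDl -prob_not //.
apply: le_trans (le_trans h3 h) _; apply: prob_le => // w [n1 n2] [q [qz o]].
have := o t.-1 tt; rewrite t1 qz.
by case=> -[e]; [have -> : q t.-1 = z - 1 by rewrite e addrK|have -> : q t.-1 = z + 1 by rewrite e subrK].
Qed.

Lemma rdual_decay M k : (k.+1)%:R ^+ 4 * rho p k <= M -> (k.+1)%:R ^+ 3 * rdual p k <= 2 * M.
Proof.
move=> h; apply: (@le_trans _ _ (2 * ((k.+1)%:R ^+ 4 * rho p k))); last by rewrite ler_pM2l.
have r0 : 0 <= rho p k by apply: rho_ge0; exact: ltW.
rewrite /rdual -subr_ge0.
have -> : 2 * ((k.+1)%:R ^+ 4 * rho p k) - (k.+1)%:R ^+ 3 * ((k.*2.+1)%:R * rho p k) =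
  (2 * (k.+1)%:R - (k.*2.+1)%:R) * ((k.+1)%:R ^+ 3 * rho p k) by ring.
apply: mulr_ge0; last by rewrite mulr_ge0 // exprn_ge0.
by rewrite subr_ge0 -natrM ler_nat; clear; lia.
Qed.

Lemma telescoping_product L :
  \prod_(k <- iota 1 L) (1 - (k.+1)%:R ^- 2) = (L.+2)%:R / (2 * (L.+1)%:R) :> R.
Proof.
elim: L => [|L IH]; first by rewrite big_nil mulr1 divff.
have -> : iota 1 L.+1 = iota 1 L ++ [:: L.+1] by rewrite -[in LHS](addn1 L) iotaD add1n.
rewrite big_cat /= IH big_seq1.
have h1 : (L.+1)%:R != 0 :> R by rewrite pnatr_eq0.
have h2 : (L.+2)%:R != 0 :> R by rewrite pnatr_eq0.
have e2 : (L.+2)%:R = (L.+1)%:R + 1 :> R by rewrite -natr1.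
have e3 : (L.+3)%:R = (L.+1)%:R + 2 :> R by rewrite -natr1 e2; ring.
rewrite e3; rewrite e2 in h2 *; move: h1 h2 {IH e2 e3}; move: (L.+1%:R : R) => x h1 h2; field.
by rewrite h1 h2.
Qed.

(** From [N] on, 2M / (k + 1)^3 is at most (k + 1)^-2; below [N] the one-step bound is used. So d is
    c^N / 2: at most [N] factors [c], and a telescoping product that stays above 1/2. The trivial
    value 1 of [r] at 0 does no harm, since the product starts at 1. *)
Lemma dual_survival_bounds M : 0 <= M -> (forall k, (k.+1)%:R ^+ 4 * rho p k <= M) ->
  exists (r : nat -> R) (d : R),
  [/\ 0 < d, d <= 1, forall k, r k <= 1,
      forall L, d <= \prod_(k <- iota 1 L) (1 - r k) &
      forall s z t k, uniq s -> (k <= t)%N -> prob p s (dual_alive z t k) <= r k].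
Proof.
move=> M0 hM; have p0' := ltW p0; have p1' := ltW p1.
pose N := (Num.trunc (2 * M)).+1.
have hN : 2 * M <= N%:R by apply/ltW; exact: truncnS_gt.
pose c := (1 - p) ^+ 2.
have c0 : 0 < c by rewrite exprn_gt0 // subr_gt0.
have c1 : c <= 1 by rewrite exprn_ile1 //; lra.
pose t (k : nat) : R := (k.+1)%:R ^- 2.
have t0 k : 0 <= t k by rewrite invr_ge0 exprn_ge0.
have t1 k : t k <= 1 by rewrite invf_le1 ?exprn_gt0 // exprn_ege1 // ler1n.
pose r k := if k == 0%N then 1 else if (k < N)%N then 1 - c else t k.
pose g (k : nat) := if (k < N)%N then c else 1.
have g0 k : 0 < g k by rewrite /g; case: ifP.
exists r, (c ^+ N / 2); split.
- by rewrite divr_gt0 // exprn_gt0.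
- have : c ^+ N <= 1 by apply: exprn_ile1 => //; exact: ltW.
  by lra.
- by move=> k; rewrite /r; case: ifP => // _; case: ifP => // _; lra.
- move=> L; apply: (@le_trans _ _ (\prod_(k <- iota 1 L) g k * \prod_(k <- iota 1 L) (1 - t k))).
    apply: ler_pM; [exact/exprn_ge0/ltW|by rewrite invr_ge0| |]; last first.
      by rewrite telescoping_product ler_pdivlMr ?mulr_gt0 // mulrA mulVf // mul1r ler_nat.
    rewrite /g -big_mkcond big_const_seq iter_mulr_1; apply: ler_wiXn2l; [exact: ltW|by []|].
    rewrite -size_filter -[leqRHS](size_iota 0); apply: uniq_leq_size.
      by rewrite filter_uniq // iota_uniq.
    by move=> k; rewrite mem_filter !mem_iota => /andP[-> _].
  rewrite -big_split /= big_seq [leRHS]big_seq; apply: ler_prod => k; rewrite mem_iota => hk.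
  apply/andP; split; first by apply: mulr_ge0; [exact: ltW|rewrite subr_ge0].
  rewrite /r /g; have -> : (k == 0%N) = false by lia.
  case: ifP => _; last by rewrite mul1r.
  by have h : 0 <= c * t k; [apply: mulr_ge0 => //; exact: ltW|lra].
- move=> s z u k us ku; rewrite /r; case: eqP => [_|k0]; first exact: prob_le1.
  case: ifP => [_|kN]; first by apply: prob_dual_alive_step => //; lia.
  apply: le_trans (prob_dual_alive p0' p1' z us ku) _.
  have := rdual_decay (hM k) => h.
  have K0 : 0 < (k.+1)%:R ^+ 3 :> R by rewrite exprn_gt0.
  have : rdual p k <= 2 * M / (k.+1)%:R ^+ 3 by rewrite ler_pdivlMr // mulrC.
  move=> /le_trans; apply; rewrite ler_pdivrMr // /t exprS mulrCA -expr2 mulVf ?mulr1.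
    apply: le_trans hN _; rewrite ler_nat; lia.
  by rewrite expf_neq0.
Qed.

End decay.

(** * Cylinder events in a bond model *)

Section law.
Context {d : measure_display} {Omega : measurableType d} {R : realType}.
Variables (P : probability Omega R) (X : bond -> Omega -> bool) (p : R).
Hypothesis modelX : bond_model P X p.

Let cfg (w : Omega) : config := fun e => X e w.

Let all_open (t : seq bond) : set Omega := \big[setI/setT]_(i <- t) [set w | X i w].

Let pattern (t u : seq bond) : set Omega :=
  all_open t `&` \big[setI/setT]_(i <- u) ~` [set w | X i w].

Let measurable_pattern t u : measurable (pattern t u).
Proof.
have [mX _] := modelX.
apply: measurableI; first by apply: bigsetI_measurable => i _; exact: mX.
by apply: bigsetI_measurable => i _; apply: measurableC; exact: mX.
Qed.

Let pattern_open e t u : pattern (e :: t) u = pattern t u `&` [set w | X e w].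
Proof. by rewrite /pattern /all_open big_cons -setIA setIC. Qed.

Let pattern_closed e t u : pattern t (e :: u) = pattern t u `&` ~` [set w | X e w].
Proof. by rewrite /pattern big_cons [X in _ `&` X = _]setIC setIA. Qed.

(** The model prescribes only the probability that finitely many bonds are all open; closed bonds
    are brought in one at a time, by subtraction. *)
Let prob_pattern t u : uniq (t ++ u) ->
  P (pattern t u) = (p ^+ size t * (1 - p) ^+ size u)%:E.
Proof.
have [mX PX] := modelX.
elim: u t => [|e u IH] t.
  rewrite cats0 => ut; rewrite /pattern big_nil setIT PX // expr0 mulr1 //.
move=> h; have h1 : uniq (t ++ u).
  by move: h; rewrite !cat_uniq /= negb_or => /and3P[-> /andP[_ ->] /andP[_ ->]].
have h2 : uniq ((e :: t) ++ u).
  by rewrite -cat1s -catA uniq_catCA -[t ++ [:: e] ++ u]/(t ++ e :: u).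
rewrite pattern_closed -[_ `&` ~` _]/(_ `\` _) measureD //=; last first.
  by rewrite (le_lt_trans (probability_le1 _ _)) ?ltry.
rewrite -pattern_open IH // IH //= -EFinD; congr EFin.
by rewrite !exprS; ring.
Qed.

Let measurable_cfg_fun (s : seq bond) (F : config -> R) : dep [set e | e \in s] F ->
  measurable_fun setT (fun w => F (cfg w)).
Proof.
have [mX PX] := modelX.
elim: s F => [|e s IH] F hF.
  rewrite (_ : (fun w => F (cfg w)) = cst (F (fun=> false))).
    exact: measurable_cst.
  by apply: funext => w /=; apply: hF.
have hb b : dep [set e' | e' \in s] (fun w => F (upd w e b)).
  move=> w w' ww'; apply: hF => e' /=; rewrite inE /upd; case: eqP => //= _; exact: ww'.
rewrite (_ : (fun w => F (cfg w)) =
    (fun w => if X e w then F (upd (cfg w) e true) else F (upd (cfg w) e false))).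
  apply: measurable_fun_ifT; [|exact: IH (hb true)|exact: IH (hb false)].
  by apply: (@measurable_fun_bool _ _ _ _ true); rewrite setTI; exact: mX.
apply: funext => w; have E b : X e w = b -> F (cfg w) = F (upd (cfg w) e b).
  move=> h; congr F; apply: funext => x; rewrite /upd.
  by case: eqP => // ->; rewrite /cfg h.
by case: ifP => /E.
Qed.

(** Splitting the integral according to the state of one more bond reproduces the recursion that
    defines [esp]; the lists [t] and [u] record the bonds already revealed. *)
Let integral_pattern t u (s : seq bond) (F : config -> R) : uniq (t ++ u ++ s) ->
  dep [set e | e \in s] F ->
  (\int[P]_(w in pattern t u) (F (cfg w))%:E = (p ^+ size t * (1 - p) ^+ size u * esp p s F)%:E)%E.
Proof.
elim: s t u F => [|e s IH] t u F.
  rewrite cats0 => us hF /=.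
  rewrite (eq_integral (cst (F (fun=> false))%:E)); last by move=> w _ /=; congr EFin; apply: hF.
  transitivity ((F (fun=> false))%:E * P (pattern t u))%E; first exact: integral_cst.
  by rewrite prob_pattern // -EFinM mulrC.
move=> us hF.
have hb b : dep [set e' | e' \in s] (fun w => F (upd w e b)).
  move=> w w' ww'; apply: hF => e' /=; rewrite inE /upd; case: eqP => //= _; exact: ww'.
have split_e : pattern t u = pattern (e :: t) u `|` pattern t (e :: u).
  by rewrite pattern_open pattern_closed -setIUr setUv setIT.
have mF : measurable_fun (pattern (e :: t) u `|` pattern t (e :: u)) (EFin \o (fun w => F (cfg w))).
  apply: measurable_funTS; apply/measurable_EFinP; exact: (measurable_cfg_fun hF).
have disj : [disjoint pattern (e :: t) u & pattern t (e :: u)].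
  by apply/disj_setPS => w; rewrite pattern_open pattern_closed => -[[_ h] [_ /=]]; exact.
rewrite {1}split_e (integral_setU P (measurable_pattern _ _) (measurable_pattern _ _) mF disj).
have E b w : X e w = b -> F (cfg w) = F (upd (cfg w) e b).
  move=> h; congr F; apply: funext => x; rewrite /upd.
  by case: eqP => // ->; rewrite /cfg h.
rewrite (eq_integral (fun w => (F (upd (cfg w) e true))%:E)); last first.
  by move=> w; rewrite inE pattern_open => -[_ /= h]; rewrite -E.
rewrite [X in (_ + X)%E](eq_integral (fun w => (F (upd (cfg w) e false))%:E)); last first.
  by move=> w; rewrite inE pattern_closed => -[_ /= h]; rewrite -E //; apply/negP.
have us1 : uniq ((e :: t) ++ u ++ s).
  rewrite (perm_uniq (s2 := t ++ u ++ e :: s)) //.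
  by apply/permP => a; rewrite /= !count_cat /=; ring.
have us2 : uniq (t ++ (e :: u) ++ s).
  rewrite (perm_uniq (s2 := t ++ u ++ e :: s)) // perm_cat2l -cat1s -[e :: s]cat1s -catA.
  by rewrite perm_catCA.
rewrite (IH (e :: t) u _ us1 (hb true)) (IH t (e :: u) _ us2 (hb false)) -EFinD; congr EFin => /=.
by rewrite !exprS; ring.
Qed.

Lemma measurable_cylinder (s : seq bond) (F : config -> R) : dep [set e | e \in s] F ->
  measurable_fun setT (fun w => F (fun e => X e w)).
Proof. exact: measurable_cfg_fun. Qed.

Lemma integral_cylinder (s : seq bond) (F : config -> R) : uniq s -> dep [set e | e \in s] F ->
  (\int[P]_w (F (fun e => X e w))%:E = (esp p s F)%:E)%E.
Proof.
move=> us hF; have := @integral_pattern [::] [::] s F us hF.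
by rewrite /pattern /all_open !big_nil setIT /= !expr0 !mul1r.
Qed.

End law.

(** * Existence of a bond model *)

Section digits.
Context {R : realType} (q : R) (q0 : 0 < q) (q1 : q < 1).

(* [digit a l k x]: at step k, does x fall in the left part (of relative length q)
   of the current interval, when one starts from [a, a + l[ ? *)
Fixpoint digit (a l : R) (k : nat) (x : R) : bool :=
  if k is k'.+1 then
    if x < a + q * l then digit a (q * l) k' x else digit (a + q * l) ((1 - q) * l) k' x
  else x < a + q * l.

Definition digit_set (a l : R) (t : pred nat) (N : nat) : set R :=
  [set x | a <= x < a + l /\ forall k, (k < N)%N -> t k -> digit a l k x].

Lemma digit_setS a l t N : 0 < l ->
  digit_set a l t N.+1 = digit_set a (q * l) (t \o S) N `|`
    (if t 0%N then set0 else digit_set (a + q * l) ((1 - q) * l) (t \o S) N).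
Proof.
move=> l0; have ql0 : 0 < q * l by exact: mulr_gt0.
have ql1 : 0 < (1 - q) * l by apply: mulr_gt0 => //; rewrite subr_gt0.
have e : a + q * l + (1 - q) * l = a + l by ring.
apply/seteqP; split=> x.
  move=> [/andP[ax xl] h]; case: (ltP x (a + q * l)) => xm.
    left; split; first by rewrite ax.
    by move=> k kN tk; have := h k.+1 kN tk; rewrite /= xm.
  right; case: ifP => t0.
    by have := h 0%N isT t0; rewrite /= ltNge xm.
  split; first by rewrite xm e.
  by move=> k kN tk; have := h k.+1 kN tk; rewrite /= ltNge xm.
case=> [[/andP[ax xm] h]|].
  split; first by rewrite ax; lra.
  by move=> [|k] kN tk /=; rewrite xm //; exact: h.
case: ifP => // t0 [/andP[mx xl] h]; split; first by rewrite -e xl andbT; lra.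
move=> [|k] kN tk; first by rewrite t0 in tk.
by rewrite /= ltNge mx; exact: h.
Qed.

(** The induction needs all starting intervals. A prescribed digit keeps only the left part, hence
    the factor [q]; a free one keeps both parts, whose lengths add up. *)
Lemma digit_set_measure N a l t : 0 < l ->
  measurable (digit_set a l t N) /\
  lebesgue_measure (digit_set a l t N) = (l * q ^+ count t (iota 0 N))%:E.
Proof.
elim: N a l t => [|N IH] a l t l0.
  have -> : digit_set a l t 0 = `[a, a + l[%classic.
    by apply/seteqP; split=> x; rewrite /= in_itv /=; [case|split].
  split; first exact: measurable_itv.
  rewrite lebesgue_measure_itv /= lte_fin ltrDl l0 expr0 mulr1 -EFinB; congr EFin; ring.
have ql0 : 0 < q * l by exact: mulr_gt0.
have ql1 : 0 < (1 - q) * l by apply: mulr_gt0 => //; rewrite subr_gt0.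
rewrite digit_setS //; have [m1 e1] := IH a (q * l) (t \o S) ql0.
have [m2 e2] := IH (a + q * l) ((1 - q) * l) (t \o S) ql1.
have -> : count t (iota 0 N.+1) = (t 0%N + count (t \o S) (iota 0 N))%N.
  by rewrite /= -[1%N]/(1 + 0)%N iotaDl count_map.
case: ifP => t0.
  by rewrite setU0; split=> //; rewrite e1 add1n exprS; congr EFin; ring.
split; first exact: measurableU.
rewrite measureU //; last first.
  by apply/seteqP; split=> // x [[/andP[_ h] _] [/andP[h' _] _]]; move: h; rewrite ltNge h'.
by rewrite [X in (X + _)%E]e1 [X in (_ + X)%E]e2 -EFinD add0n; congr EFin; ring.
Qed.

Definition digit_bond (e : bond) (x : R) : bool := (0 <= x < 1) && digit 0 1 (pickle e) x.

Lemma uniform_prob_unit (A : set R) : measurable A -> A `<=` [set x | 0 <= x < 1] ->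
  uniform_prob (@ltr01 R) A = lebesgue_measure A.
Proof.
move=> mA sA; rewrite /uniform_prob (eq_integral (cst 1%E)); last first.
  move=> x; rewrite inE => /sA /= /andP[x0 x1].
  by rewrite /uniform_pdf x0 (ltW x1) subr0 invr1.
by rewrite integral_cst // mul1e.
Qed.

(** The condition [theta_zero q] speaks about all bond models with parameter [q], so nothing follows
    from it until one such model is exhibited. *)
Lemma digit_model : bond_model (uniform_prob (@ltr01 R)) digit_bond q.
Proof.
have fam (s : seq bond) : s != [::] -> uniq s ->
    exists N, \big[setI/setT]_(i <- s) [set w | digit_bond i w] =
      digit_set 0 1 (mem [seq pickle e | e <- s]) N /\
      count (mem [seq pickle e | e <- s]) (iota 0 N) = size s.
  move=> s0 us; exists (\max_(e <- s) pickle e).+1.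
  have bnd e : e \in s -> (pickle e < (\max_(e <- s) pickle e).+1)%N.
    by move=> es; rewrite ltnS; apply: leq_bigmax_seq.
  split; last first.
    rewrite -(size_map pickle) -size_filter; apply: perm_size; apply: uniq_perm.
    - by rewrite filter_uniq // iota_uniq.
    - by rewrite map_inj_uniq //; exact: pcan_inj pickleK.
    - move=> k; rewrite mem_filter mem_iota /=.
      by case: (boolP (k \in _)) => //= /mapP[e es ->]; exact: bnd.
  rewrite -bigcap_seq; apply/seteqP; split=> x.
    move=> h; split.
      case: s s0 h {us bnd} => // e s _ /(_ e); rewrite /= mem_head => /(_ isT).
      by rewrite /digit_bond add0r => /andP[].
    by move=> k kN /mapP[e es ->]; have := h e es; rewrite /= /digit_bond => /andP[].
  move=> [hx h] e es /=; rewrite /digit_bond -[X in _ < X]add0r hx /=; apply: h; first exact: bnd.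
  exact: map_f.
split=> [e|s us].
  have [||N [h _]] := fam [:: e]; rewrite //.
  by move: h; rewrite big_seq1 => ->; have [] := digit_set_measure N 0 (mem [seq pickle e | e <- [:: e]]) (@ltr01 R).
case: (eqVneq s [::]) => [->|s0].
  by rewrite big_nil expr0; exact: probability_setT.
have [N [-> hc]] := fam s s0 us.
have [m e] := digit_set_measure N 0 (mem [seq pickle e | e <- s]) (@ltr01 R).
transitivity (lebesgue_measure (digit_set 0 1 (mem [seq pickle e | e <- s]) N)).
  by apply: (uniform_prob_unit m) => x [/= + _]; rewrite add0r.
by rewrite [LHS]e hc mul1r.
Qed.

End digits.

(** * Survival probabilities in a bond model and the use of the critical value *)

Section events.
Context {d : measure_display} {Omega : measurableType d} {R : realType}.
Variables (P : probability Omega R) (X : bond -> Omega -> bool) (p : R).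
Hypothesis modelX : bond_model P X p.

Lemma measurable_event (s : seq bond) (Q : config -> Prop) : dep [set e | e \in s] Q ->
  measurable [set w | Q (fun e => X e w)].
Proof.
move=> hQ; have := measurable_cylinder modelX (dep_ind (R := R) hQ).
move=> /(_ measurableT [set 1] (measurable_set1 _)); rewrite setTI.
congr measurable; apply/seteqP; split=> w /=; last exact: ind_true.
move=> h; apply: contrapT => nQ; move: h; rewrite ind_false // => /esym/eqP.
by rewrite oner_eq0.
Qed.

Lemma prob_event (s : seq bond) (Q : config -> Prop) : uniq s -> dep [set e | e \in s] Q ->
  P [set w | Q (fun e => X e w)] = (prob p s Q)%:E.
Proof.
move=> us hQ; rewrite /prob -(integral_cylinder modelX us (dep_ind (R := R) hQ)).
rewrite -[X in P X]setIT -integral_indic //; last exact: measurable_event hQ.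
Qed.

Lemma alive_cfg n : alive X n = [set w | alive cfg_coord n (fun e => X e w)].
Proof. by apply/seteqP; split=> w; rewrite /alive /= (xi_coord X). Qed.

Lemma alive_box_dep n : dep [set e | e \in box n n] (alive cfg_coord n).
Proof. by apply: dep_sub (@alive_dep n); exact: cone_box. Qed.

Lemma measurable_alive n : measurable (alive X n).
Proof. by rewrite alive_cfg; apply: measurable_event; exact: alive_box_dep. Qed.

Lemma prob_alive n : P (alive X n) = (rho p n)%:E.
Proof. by rewrite alive_cfg; apply: prob_event; [exact: uniq_box|exact: alive_box_dep]. Qed.

Lemma prob_survive : 0 <= p -> p <= 1 -> rho p n @[n --> \oo] --> fine (P (survive X)).
Proof.
move=> p0 p1.
have -> : survive X = \bigcap_n alive X n.
  by apply/seteqP; split=> [w h n _|w h n]; [exact: h|exact: (h n I)].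
have : P (alive X n) @[n --> \oo] --> P (\bigcap_n alive X n).
  apply: nonincreasing_cvg_mu.
  - by rewrite (le_lt_trans (probability_le1 _ _)) ?ltry //; exact: measurable_alive.
  - exact: measurable_alive.
  - by apply: bigcap_measurable => [|n _]; [exists 0%N|exact: measurable_alive].
  - apply/nonincreasing_seqP => n; apply/subsetPset => w.
    rewrite !alive_cfg /= !alive_path => -[q [h1 h2]]; exists q; split=> //.
    exact: opath_sub h2.
rewrite -[X in _ --> X -> _]fineK; last first.
  apply: fin_num_measure; apply: bigcap_measurable => [|n _]; first by exists 0%N.
  exact: measurable_alive.
move=> /fine_cvg.
by apply: cvg_trans; apply: near_eq_cvg; apply: nearW => n /=; rewrite prob_alive.
Qed.

End events.

Lemma rho_not_bounded_below (R : realType) (q e : R) : 0 < q -> q < 1 -> theta_zero q -> 0 < e ->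
  ~ forall n, e <= rho q n.
Proof.
move=> q0 q1 tq e0 h; have m := digit_model q0 q1.
have := prob_survive m (ltW q0) (ltW q1); rewrite (tq _ _ _ _ m) /= => c.
have : e <= 0 by apply: (cvgr_to_ge c); apply: nearW.
by rewrite leNgt e0.
Qed.

(** By definition of the supremum there is q > p without percolation. The second alternative of
    [sharpness] would keep [rho q] above (q - p) / (1 + q - p), so the first one holds. *)
Lemma subcritical_decay (R : realType) (p : R) : 0 < p -> p < p_c R ->
  p < 1 /\ exists2 M, 0 <= M & forall k, (k.+1)%:R ^+ 4 * rho p k <= M.
Proof.
move=> p0; rewrite /p_c; set S := [set q : R | _] => pc.
(* The supremum of the empty set is 0 by convention, which is incompatible with 0 < p < p_c. *)
have S0 : S !=set0.
  by apply/set0P/eqP => e; move: pc; rewrite e sup0 ltNge ltW.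
have [q [/andP[q0 q1] tq] pq] := sup_gt S0 pc.
have p1 : p < 1 by exact: lt_trans q1.
split=> //; have [[h [a [h0 a0 a1 hr]]]|hlow] := sharpness (ltW p0) pq (ltW q1).
  exact: rho_decay hr.
have d0 : 0 < q - p by rewrite subr_gt0.
have d1 : 0 < 1 + (q - p) by lra.
exfalso; apply: (@rho_not_bounded_below _ q ((q - p) / (1 + (q - p)))) => //.
  exact: divr_gt0.
move=> n; rewrite ler_pdivrMr //.
have hl : (q - p) * (1 - rho q n) <= rho q n by exact: hlow.
by lra.
Qed.

(** * Passage to the limit *)

Definition cylinder (x : cantor_space) (n : nat) : set cantor_space :=
  [set y | forall k, (k < n)%N -> x k = y k].

Lemma cylinder_filter x : ProperFilter (filter_from setT (cylinder x)).
Proof.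
apply: filter_from_proper; last by move=> n _; exists x.
apply: filter_from_filter; first by exists 0%N.
move=> i j _ _; exists (maxn i j) => // y h; split=> k kn; apply: h; rewrite leq_max kn ?orbT //.
Qed.

Lemma nbhs_cantor (x : cantor_space) (V : set cantor_space) :
  nbhs x V <-> exists n, cylinder x n `<=` V.
Proof.
have FF := cylinder_filter x; split=> [xV|[n nV]].
  have : filter_from setT (cylinder x) --> x.
    apply/cvg_sup => i A; rewrite (@nbhsE (initial_topology (fun g : nat -> bool => g i))) => -[B [[C oC <-] Bx] BA].
    exists i.+1 => // y hy; apply: BA; rewrite /= /proj in Bx *.
    by rewrite -(hy i (ltnSn i)).
  by move=> /(_ V xV) [n _ h]; exists n.
apply: filterS nV _.
elim: n => [|n IH]; first by apply: filterS filterT => y _.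
have : nbhs x (proj n @^-1` [set x n]).
  apply: (@proj_continuous nat (fun=> bool) n x); exact: discrete_set1.
move=> h; apply: filterS (filterI IH h) => y [h1 h2] k.
by rewrite ltnS leq_eqVlt => /orP[/eqP ->|/h1 //].
Qed.

Section continuous_cantor.
Context {R : realType} (f : cantor_space -> R) (cf : continuous f).

(** Compactness makes [K] independent of the point; this reduces weak convergence to finitely many
    sites near the tip. *)
Lemma cantor_unif (e : R) : 0 < e ->
  exists K, forall a b : cantor_space, (forall k, (k < K)%N -> a k = b k) -> `|f a - f b| <= e.
Proof.
move=> e0.
pose Q (n : nat) (a : cantor_space) := forall b, cylinder a n b -> `|f a - f b| <= e.
have e2 : 0 < e / 2 by rewrite divr_gt0.
have [N _ hN] : \forall n \near \oo, [set: cantor_space] `<=` Q n.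
  apply: ((compact_near_coveringP _).1 cantor_space_compact) => x _.
  have /nbhs_cantor [N hN] : nbhs x [set y | `|f x - f y| < e / 2].
    by have /cvgrPdist_lt/(_ _ e2) := @cf x.
  exists (cylinder x N, [set n | (N <= n)%N]).
    by split=> /=; [apply/nbhs_cantor; exists N|exists N].
  move=> [a n] /= [xa Nn] b ab.
  have h1 := hN a xa; have h2 : `|f x - f b| < e / 2.
    by apply: hN => k kN; rewrite xa // ab //; exact: leq_trans kN Nn.
  rewrite -[f a - f b](subrKA (f x)) (le_trans (ler_normD _ _)) // [e]splitr lerD ?ltW // distrC //.
by exists N => a b h; exact: (hN N (leqnn N) a I b h).
Qed.

Lemma cantor_bounded : exists C, forall a, `|f a| <= C.
Proof.
have cont : {within [set: cantor_space], continuous f}.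
  by apply: continuous_subspaceT.
have := continuous_compact cont cantor_space_compact.
move=> /compact_bounded [M [_ hM]]; exists (M + 1) => a.
by apply: (hM (M + 1)); [rewrite ltrDl|exists a].
Qed.

End continuous_cantor.

Lemma harmonic_small (R : realType) (c e : R) : 0 < e -> exists L0, forall L, (L0 <= L)%N ->
  c / (L.+1)%:R <= e.
Proof.
move=> e0; exists (Num.trunc (c / e)) => L hL.
rewrite ler_pdivrMr // mulrC -ler_pdivrMr //; apply/ltW; apply: lt_le_trans (truncnS_gt _) _.
by rewrite ler_nat.
Qed.

Definition killed (B : set int) (n : nat) (w : config) : Prop :=
  ~ exists q, B (q 0%N) /\ opath w q 0 n.

Section finite_limit.
Context {R : realType} (p : R) (p0 : 0 < p) (p1 : p < 1).
Variable M : R.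
Hypothesis M0 : 0 <= M.
Hypothesis hM : forall k, (k.+1)%:R ^+ 4 * rho p k <= M.

Let rdual_small (c e : R) : 0 <= c -> 0 < e -> exists L0, forall L k, (L0 <= L)%N -> (L <= k)%N ->
  c * rdual p k <= e /\ c * (k%:R * rdual p k) <= e.
Proof.
move=> c0 e0; have [L0 hL] := harmonic_small (c * (2 * M)) e0.
exists L0 => L k L0L Lk.
have p0' := ltW p0; have p1' := ltW p1.
have K1 : 1 <= (k.+1)%:R :> R by rewrite ler1n.
have K0 : 0 < (k.+1)%:R :> R by rewrite ltr0n.
have r0 : 0 <= rdual p k by exact: rdual_ge0.
have kK : k%:R <= (k.+1)%:R :> R by rewrite ler_nat.
have h : (k.+1)%:R ^+ 3 * rdual p k <= 2 * M by exact: rdual_decay (hM k).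
have key : (k.+1)%:R * rdual p k <= 2 * M / (k.+1)%:R.
  rewrite ler_pdivlMr //; apply: le_trans h.
  rewrite mulrAC -expr2; apply: ler_wpM2r => //.
  by rewrite [leRHS]exprS ler_peMl // exprn_ge0 // ltW.
have bnd : c * ((k.+1)%:R * rdual p k) <= e.
  apply: le_trans (ler_wpM2l c0 key) _; rewrite mulrA; apply: hL; exact: leq_trans Lk.
split; apply: le_trans bnd; apply: ler_wpM2l => //; last exact: ler_wpM2r.
by rewrite ler_peMl.
Qed.

(** The order of the choices matters: [K] from the uniform continuity of [f], then the number of
    candidate times, and only then the spacing [L], whose error terms contain the other two. None of
    them depends on [B] or [W]. *)
Lemma finite_start_limit (f : cantor_space -> R) (l C : R) : continuous f ->
  (forall a, `|f a - l| <= C) ->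
  (forall e, 0 < e -> exists n1, forall m, (n1 <= m)%N ->
     `|esp p (box m m) (fun w => ind (alive cfg_coord m w) * (f (zeta_ind cfg_coord [set 0] m w) - l))|
     <= e * rho p m) ->
  forall e, 0 < e -> exists n0, forall n (B : set int) (W : nat), (n0 <= n)%N ->
    (forall x, B x -> evenz x) -> (forall x, B x -> - W%:Z <= x <= W%:Z) ->
    `|esp p (box (W + n.*2) n) (fun w => f (zeta_ind cfg_coord B n w) - l)| <=
    e + C * prob p (box (W + n.*2) n) (killed B n).
Proof.
move=> cf fC hc e e0; have p0' := ltW p0; have p1' := ltW p1.
have C0 : 0 <= C by exact: le_trans (normr_ge0 _) (fC (fun=> false)).
have [r [d [d0 d1 r1 rprod rdual_le]]] := dual_survival_bounds p0 p1 M0 hM.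
(* Five error terms of this size will arise, apart from the extinction term. *)
have e8 : 0 < e / 8 by rewrite divr_gt0.
have [K hK] := cantor_unif cf e8.
have [n1 hn1] := hc _ e8.
have [J hJ] : exists J, C * (1 - d) ^+ J.+1 <= e / 8.
  have d0' : 0 <= 1 - d by lra.
  have d1' : 1 - d < 1 by lra.
  have [L0 hL] := harmonic_small (C / d) e8.
  exists L0; apply: le_trans (hL L0.+1 (leqnSn _)).
  rewrite -mulrA; apply: ler_wpM2l => //.
  have := linear_geometric L0.+1 d0' d1'; have -> : 1 - (1 - d) = d by ring.
  move=> h; rewrite -invfM -[leRHS]mul1r ler_pdivlMr ?mulr_gt0 //.
  by apply: le_trans h; rewrite le_eqVlt; apply/orP; left; apply/eqP; ring.
(* One constant dominating both the coefficient of L times [rdual p L] and that of [rdual p JL]. *)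
pose c := C * J.+1%:R * 4 * J.+1%:R + 2 * C * K%:R.
have c0 : 0 <= c by rewrite addr_ge0 ?mulr_ge0.
have [L0 hL] := rdual_small c0 e8.
pose L := maxn L0 n1; pose JL := (J.+1 * L)%N.
have LJL : (L <= JL)%N by rewrite leq_pmull.
have L0L : (L0 <= L)%N by exact: leq_maxl.
have [_ hL1] := hL L L L0L (leqnn L); have [hL2 _] := hL L JL L0L LJL.
exists (2 * JL)%N => n B W hn evenB BW.
(* To be used twice, for [f] and for - f. *)
have side (g : cantor_space -> R) (k : R) : (forall a, `|g a - k| <= C) ->
    (forall a b : cantor_space, (forall i, (i < K)%N -> a i = b i) -> `|g a - g b| <= e / 8) ->
    (forall m, (JL <= m)%N ->
      esp p (box m m) (fun w => ind (alive cfg_coord m w) * (g (zeta_ind cfg_coord [set 0] m w) - k))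
      <= e / 8 * rho p m) ->
    esp p (box (W + n.*2) n) (fun w => g (zeta_ind cfg_coord B n w) - k) <=
    e + C * prob p (box (W + n.*2) n) (killed B n).
  move=> gC gK gc.
  have := esp_zeta_le p0' p1' rdual_le r1 rprod d1 evenB BW hn gC gK gc (ltW e8) (ltW e8).
  move=> h; apply: le_trans h _.
  have t1 : C * (J.+1%:R * ((4 * (J.+1 * L))%:R * rdual p L)) <= e / 8.
    apply: le_trans hL1; rewrite !natrM /c.
    rewrite [leRHS]mulrDl -[leLHS]addr0; apply: lerD.
      by rewrite le_eqVlt; apply/orP; left; apply/eqP; ring.
    by apply: mulr_ge0; [rewrite !mulr_ge0|apply: mulr_ge0 => //; exact: rdual_ge0].
  have t2 : 2 * C * (K%:R * rdual p JL) <= e / 8.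
    apply: le_trans hL2; rewrite /c [leRHS]mulrDl -[leLHS]add0r; apply: lerD.
      by apply: mulr_ge0; [rewrite !mulr_ge0|exact: rdual_ge0].
    by rewrite le_eqVlt; apply/orP; left; apply/eqP; ring.
  rewrite -/(killed B n) mulrDr.
  move: hJ t1 t2; rewrite -/JL; set x1 := C * _ ^+ _; set x2 := C * (_ * _); set x3 := 2 * C * _.
  set x4 := C * prob _ _ _ => hJ t1 t2.
  by lra.
have le1 := side f l fC hK _.
have le2 := side (fun a => - f a) (- l) _ _ _.
rewrite ler_norml; apply/andP; split.
  rewrite lerNl -espN.
  have -> : esp p (box (W + n.*2) n) (fun w => - (f (zeta_ind cfg_coord B n w) - l)) =
     esp p (box (W + n.*2) n) (fun w => - f (zeta_ind cfg_coord B n w) - - l).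
    by apply: esp_ext => w; ring.
  apply: le2.
  - by move=> a; rewrite -opprD normrN.
  - by move=> a b ab; rewrite -opprD normrN; exact: hK.
  - move=> m hm; have := hn1 m _; rewrite ler_norml => /(_ _)/andP[].
      by apply: leq_trans hm; apply: leq_trans LJL; exact: leq_maxr.
    rewrite lerNl -espN => h _; apply: le_trans h.
    by rewrite le_eqVlt; apply/orP; left; apply/eqP/esp_ext => w; ring.
apply: le1 => m hm; apply: le_trans (ler_norm _) (hn1 m _).
by apply: leq_trans hm; apply: leq_trans LJL; exact: leq_maxr.
Qed.

End finite_limit.

(** * Truncation of the infinite initial set *)

Definition truncate (A : set int) (N : nat) : set int := [set x | A x /\ - N%:Z <= x].

Lemma in_S_even A : in_S A -> forall x, A x -> evenz x.
Proof.
move=> [sA _] x /sA [_ h]; exists (x %/ 2)%Z.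
by have := h; lia.
Qed.

Lemma in_S_unbounded A (b : int) : in_S A -> exists2 x, A x & x < b.
Proof.
move=> [sA [_ nfin]]; apply: contrapT => h; apply: nfin.
apply: (@sub_finite_set _ _ [set` ints (absz b)]); last exact: finite_seq.
move=> x Ax /=; rewrite mem_ints; have [x0 _] := sA x Ax.
case: (ltP x b) => xb; first by exfalso; apply: h; exists x.
by lia.
Qed.

Lemma xi_box_dep (B : set int) (W n : nat) : (forall x, B x -> - W%:Z <= x <= W%:Z) ->
  dep [set e | e \in box (W + n.*2) n] (xi cfg_coord B n).
Proof.
move=> BW.
have half (w w' : config) : (forall e, [set e | e \in box (W + n.*2) n] e -> w e = w' e) ->
    xi cfg_coord B n w `<=` xi cfg_coord B n w'.
  move=> ww' y /xi_path [q [Bq qy oq]]; apply/xi_path; exists q; split=> //.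
  apply: opath_dep ww' _ (oq) => u b ub /=; rewrite mem_box.
  have := @opath_drift _ _ _ _ 0%N u oq ltac:(lia) ltac:(lia); have := BW _ Bq; lia.
by move=> w w' ww'; apply/seteqP; split; apply: half => // e he; rewrite ww'.
Qed.

Section killed_limit.
Context {R : realType} (p : R) (p0 : 0 <= p) (p1 : p <= 1).

(* The points xs are more than 2n apart, so that their cones up to level n are disjoint. *)
Lemma prob_all_killed (A : set int) (n j : nat) : in_S A ->
  exists (xs : seq int) (b : int), [/\ forall x, x \in xs -> A x, forall x, x \in xs -> b <= x &
    forall s, uniq s -> (forall x e, x \in xs -> e \in box n n -> shift_bond x 0 e \in s) ->
      prob p s (fun w => forall x, x \in xs -> ~ alive_from x 0 n w) <= (1 - rho p n) ^+ j].
Proof.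
move=> SA; elim: j => [|j [xs [b [xsA xsb IH]]]].
  by exists [::], 0; split=> // s us _; rewrite expr0; exact: prob_le1.
have [x Ax xb] := in_S_unbounded (b - (n.*2)%:Z) SA.
exists (x :: xs), x; split.
- by move=> y; rewrite inE => /orP[/eqP ->|/xsA].
- by move=> y; rewrite inE => /orP[/eqP ->|/xsb]; lia.
move=> s us hs.
have hx : prob p s (alive_from x 0 n) = rho p n.
  rewrite /rho /prob -(@esp_shift _ p s x 0 n) //.
  - by apply: esp_ext => w; apply: ind_eq; rewrite alive_shift.
  - exact/dep_ind/alive_box_dep.
  - by move=> _ /mapP[e he ->]; apply: hs; rewrite ?mem_head.
rewrite exprS -[X in (1 - X) * _]hx -prob_not.
apply: (@le_trans _ _ (prob p s (fun w => ~ alive_from x 0 n w /\ forall y, y \in xs -> ~ alive_from y 0 n w))).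
  by apply: prob_le => // w h; split=> [|y yx]; apply: h; rewrite inE ?eqxx // yx orbT.
have da y : dep (cone y 0 n) (alive_from y 0 n).
  apply: dep_prop => w w' ww' [q [q0 o]]; exists q; split=> //.
  exact: opath_dep ww' (fun u d => cone_opath d o q0) o.
rewrite (@prob_indep _ p s (cone x 0 n) [set e | b - n%:Z <= e.1.1]).
- apply: ler_wpM2l; first exact: prob_ge0.
  by apply: IH => // y e yx; apply: hs; rewrite inE yx orbT.
- exact/dep_not/da.
- apply: dep_prop => w w' ww' h y yx ha; apply: (h y yx).
  rewrite (da y w w') // => e; rewrite /cone /= => -[h1 h2 h3 h4]; apply: ww' => /=.
  by have := xsb y yx; lia.
- by move=> e; rewrite /cone /= => -[h1 h2 h3 h4]; lia.
Qed.

(** With [n] fixed, [j] far apart points of [A] give independent trials with success probability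
    [rho p n]; [N] only has to be large enough to retain these points. *)
Lemma prob_killed_small (A : set int) (n : nat) (e : R) : in_S A -> 0 < rho p n -> 0 < e ->
  exists N0, forall N, (N0 <= N)%N ->
    prob p (box (N + n.*2) n) (killed (truncate A N) n) <= e.
Proof.
move=> SA r0 e0.
have r1 : rho p n <= 1 by exact: prob_le1.
have [j hj] : exists j, (1 - rho p n) ^+ j <= e.
  have x0 : 0 <= 1 - rho p n by lra.
  have x1 : 1 - rho p n < 1 by lra.
  have [L0 hL] := harmonic_small ((rho p n)^-1) e0.
  exists L0; apply: le_trans (hL L0 (leqnn _)).
  have := linear_geometric L0 x0 x1; have -> : 1 - (1 - rho p n) = rho p n by ring.
  move=> h; rewrite -invfM -[leRHS]mul1r ler_pdivlMr ?mulr_gt0 //.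
  by apply: le_trans h; rewrite le_eqVlt; apply/orP; left; apply/eqP; ring.
have [xs [b [xsA xsb hxs]]] := prob_all_killed n j SA.
exists (absz b) => N bN.
have [sA _] := SA.
apply: le_trans hj; apply: le_trans (hxs (box (N + n.*2) n) (uniq_box _ _) _); last first.
  move=> x [[y u] c] xx; rewrite /shift_bond !mem_box /=.
  by have := xsb x xx; have [x0 _] := sA x (xsA x xx); lia.
apply: prob_le => // w h x xx [q [q0 o]]; apply: h; exists q; split=> //.
by rewrite q0; split; [exact: xsA|have := xsb x xx; lia].
Qed.

End killed_limit.

(** The first [K] coordinates are decided by paths ending less than 2K below the maximum [r], and
    these start no lower than r - 2K - n. The threshold depends on [w] through [r], so the
    convergence is only pointwise and calls for dominated convergence afterwards. *)
Lemma zeta_truncate (A : set int) (n K : nat) (w : config) : in_S A ->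
  exists N0, forall N, (N0 <= N)%N -> forall k, (k < K)%N ->
    zeta_ind cfg_coord (truncate A N) n w k = zeta_ind cfg_coord A n w k.
Proof.
move=> SA; have [sA _] := SA.
have sub N y : xi cfg_coord (truncate A N) n w y -> xi cfg_coord A n w y.
  by move=> /xi_path [q [[Aq _] qy o]]; apply/xi_path; exists q.
have bnd y : xi cfg_coord A n w y -> y <= n%:Z.
  move=> /xi_path [q [Aq <- o]]; have [q0 _] := sA _ Aq.
  by have := @opath_drift _ _ _ _ 0%N n o ltac:(lia) ltac:(lia); lia.
case: (pselect (exists y, xi cfg_coord A n w y)) => [[y0 hy0]|nex]; last first.
  exists 0%N => N _ k _; apply: asbool_equiv_eq.
  by split=> -[r [h _]]; exfalso; apply: nex; exists r => //; exact: sub h.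
pose Q m := `[< xi cfg_coord A n w (n%:Z - m%:Z) >].
have exQ : exists m, Q m.
  exists (absz (n%:Z - y0)); apply/asboolP; have := bnd _ hy0.
  by move=> ?; have -> : n%:Z - (absz (n%:Z - y0))%:Z = y0 by lia.
have [m /asboolP hm mmin] := ex_minnP exQ.
set r := n%:Z - m%:Z in hm.
have rmax y : xi cfg_coord A n w y -> y <= r.
  move=> hy; have := bnd _ hy => yn.
  have := mmin (absz (n%:Z - y)); rewrite /Q.
  have -> : n%:Z - (absz (n%:Z - y))%:Z = y by lia.
  by rewrite asboolT // => /(_ isT); rewrite /r; lia.
exists (absz r + K.*2 + n)%N => N hN k kK; apply: asbool_equiv_eq.
have back y : r - (2 * k)%:Z <= y -> xi cfg_coord A n w y -> xi cfg_coord (truncate A N) n w y.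
  move=> ry /xi_path [q [Aq qy o]]; apply/xi_path; exists q; split=> //; split=> //.
  by have := @opath_drift _ _ _ _ 0%N n o ltac:(lia) ltac:(lia); lia.
rewrite !(@zeta_max _ _ _ _ _ r) //.
- by split; [exact: sub|apply: back; lia].
- by apply: back => //; lia.
- by move=> y /sub; exact: rmax.
Qed.

Section expectations.
Context {d : measure_display} {Omega : measurableType d} {R : realType}.
Variables (P : probability Omega R) (X : bond -> Omega -> bool) (p : R).
Hypothesis modelX : bond_model P X p.
Variables (f : cantor_space -> R) (cf : continuous f).

Lemma expect_truncate A N n : in_S A ->
  expect_f P X (truncate A N) f n =
  esp p (box (N + n.*2) n) (fun w => f (zeta_ind cfg_coord (truncate A N) n w)).
Proof.
move=> [sA _]; rewrite /expect_f.
have BW x : truncate A N x -> - N%:Z <= x <= N%:Z.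
  by move=> [Ax Nx]; have [x0 _] := sA x Ax; lia.
rewrite -[RHS]/(fine (_%:E)) -(integral_cylinder modelX (uniq_box _ _)).
  by congr fine; apply: eq_integral => w _; rewrite zeta_ind_coord.
by move=> w w' /(xi_box_dep BW) e; rewrite /zeta_ind /zeta e.
Qed.

Lemma expect_truncate_cvg A n : in_S A ->
  expect_f P X (truncate A N) f n @[N --> \oo] --> expect_f P X A f n.
Proof.
move=> SA; have [C hC] := cantor_bounded cf.
have ptw w : f (zeta_ind X (truncate A N) n w) @[N --> \oo] --> f (zeta_ind X A n w).
  apply/cvgrPdist_le => e e0; have [K hK] := cantor_unif cf e0.
  have [N0 hN] := zeta_truncate n K (fun e => X e w) SA.
  exists N0 => // N NN0 /=; apply: hK => k kK.
  by rewrite [in RHS]zeta_ind_coord [in LHS]zeta_ind_coord hN.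
have mN N : measurable_fun setT (fun w => f (zeta_ind X (truncate A N) n w)).
  have [sA _] := SA.
  have BW x : truncate A N x -> - N%:Z <= x <= N%:Z.
    by move=> [Ax Nx]; have [x0 _] := sA x Ax; lia.
  rewrite (_ : (fun w => _) = (fun w => f (zeta_ind cfg_coord (truncate A N) n (fun e => X e w)))); last first.
    by apply: funext => w; rewrite zeta_ind_coord.
  apply: (measurable_cylinder modelX (s := box (N + n.*2) n)
    (F := fun w => f (zeta_ind cfg_coord (truncate A N) n w))).
  by move=> w w' /(xi_box_dep BW) e; rewrite /zeta_ind /zeta e.
have mf : measurable_fun setT (fun w => f (zeta_ind X A n w)).
  by apply: (measurable_fun_cvg mN) => w _; exact: ptw.
have [|||||inte _] := @dominated_convergence _ _ _ P setT measurableT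
  (fun N w => (f (zeta_ind X (truncate A N) n w))%:E) (fun w => (f (zeta_ind X A n w))%:E) (cst C%:E).
- by move=> N; apply/measurable_EFinP.
- exact/measurable_EFinP.
- by apply: aeW => w _; apply: cvg_EFin; [exact: nearW|exact: ptw].
- by apply: finite_measure_integrable_cst.
- by apply: aeW => w N _; rewrite /= lee_fin.
rewrite /expect_f => h.
by apply: fine_cvg; rewrite fineK //; exact: integrable_fin_num.
Qed.

Hypothesis p0 : 0 < p.

(** The straight path that always steps to the right is open with probability p^n. *)
Lemma rho_gt0 n : 0 < rho p n.
Proof.
have [mX PX] := modelX.
pose s : seq bond := [seq (u%:Z, u, true) | u <- iota 0 n].
have us : uniq s by rewrite map_inj_uniq ?iota_uniq // => u v [].
rewrite -lte_fin -(prob_alive modelX); apply: (@lt_le_trans _ _ (p ^+ size s)%:E).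
  by rewrite lte_fin exprn_gt0.
rewrite -(PX s us); apply: le_measure; rewrite ?inE.
- by apply: bigsetI_measurable => i _; exact: mX.
- exact: measurable_alive modelX n.
- move=> w; rewrite -bigcap_seq => h; rewrite alive_cfg /= alive_path.
  exists (fun u => u%:Z); split=> // u ub; left; split; first by rewrite -addn1 PoszD.
  by apply: (h (u%:Z, u, true)); apply/mapP; exists u; rewrite ?mem_iota.
Qed.

Lemma cond_expect_esp m l :
  esp p (box m m) (fun w => ind (alive cfg_coord m w) * (f (zeta_ind cfg_coord [set 0] m w) - l)) =
  (cond_expect_f P X f m - l) * rho p m.
Proof.
have dz : dep [set e | e \in box m m] (fun w => ind (alive cfg_coord m w) * f (zeta_ind cfg_coord [set 0] m w)).
  apply: dep_sub (@cone_box m) _ => w w' ww'.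
  by rewrite (zeta_ind_dep ww') (alive_dep ww').
have -> : esp p (box m m) (fun w => ind (alive cfg_coord m w) * (f (zeta_ind cfg_coord [set 0] m w) - l)) =
    esp p (box m m) (fun w => ind (alive cfg_coord m w) * f (zeta_ind cfg_coord [set 0] m w)) - l * rho p m.
  by rewrite /rho /prob -espZ -espB; apply: esp_ext => w; ring.
rewrite mulrBl; congr (_ - _).
rewrite /cond_expect_f (prob_alive modelX) /= divfK ?gt_eqF ?rho_gt0 //.
rewrite -[LHS]/(fine (_%:E)) -(integral_cylinder modelX (uniq_box m m) dz).
congr fine; rewrite [RHS]integral_mkcond; apply: eq_integral => w _.
rewrite patchE; case: (boolP (w \in alive X m)) => h.
  have h' : alive cfg_coord m (fun e => X e w) by move: h; rewrite inE alive_cfg.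
  by rewrite (ind_true h') mul1r (zeta_ind_coord X).
rewrite ind_false ?mul0r // => h'; move/negP: h; apply.
by rewrite inE alive_cfg.
Qed.

End expectations.

(* Weak convergence on {0,1}^{2Z_-} (compact metrizable): for every
   continuous f, E f(zeta^A_n) -> int f dnu, where int f dnu is the limit of
   E[f(zeta^{0}_n) | T > n]. *)
Theorem theorem1p2 (R : realType) (d : measure_display)
  (Omega : measurableType d) (P : probability Omega R)
  (X : bond -> Omega -> bool) (p : R) :
  0 < p -> p < p_c R -> bond_model P X p ->
  forall A : set int, in_S A ->
  forall (f : cantor_space -> R), continuous f ->
  forall L : R,
    cond_expect_f P X f n @[n --> \oo] --> L ->
    expect_f P X A f n @[n --> \oo] --> L.
Proof.
move=> p0 pc modelX A SA f cf L condL.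
have [p1 [M M0 hM]] := subcritical_decay p0 pc.
have [C0 hC0] := cantor_bounded cf.
pose C : R := C0 + `|L|.
have fC a : `|f a - L| <= C by apply: le_trans (ler_normB _ _) _; rewrite lerD2r.
have hc (e : R) : 0 < e -> exists n1, forall m, (n1 <= m)%N ->
    `|esp p (box m m) (fun w => ind (alive cfg_coord m w) * (f (zeta_ind cfg_coord [set 0] m w) - L))|
    <= e * rho p m.
  move=> e0; have /cvgrPdist_le/(_ _ e0) [n1 _ hn1] := condL.
  exists n1 => m n1m; have rm := rho_gt0 modelX p0 m.
  rewrite (cond_expect_esp modelX f p0) normrM (gtr0_norm rm); apply: ler_wpM2r; first exact: ltW.
  by rewrite distrC; exact: hn1.
apply/cvgrPdist_le => /= e e0.
have e3 : 0 < e / 3 by rewrite divr_gt0.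
have [n0 hn0] := finite_start_limit p0 p1 M0 hM cf fC hc e3.
exists n0 => // n n0n /=.
(* C + 1 replaces [C] as a divisor, since [C] may be 0. *)
have C1 : 0 < C + 1.
  by rewrite ltr_wpDl //; exact: le_trans (normr_ge0 _) (fC (fun=> false)).
have eC : 0 < e / 3 / (C + 1) by rewrite divr_gt0.
have [N0 hN0] := prob_killed_small (ltW p0) (ltW p1) SA (rho_gt0 modelX p0 n) eC.
have /cvgrPdist_le/(_ _ e3) [N1 _ hN1] := @expect_truncate_cvg _ _ _ P X p modelX f cf A n SA.
(* The truncation is chosen after [n], which is legitimate because [n0] does not depend on it. *)
pose N := maxn N0 N1.
have k1 := hN1 N (leq_maxr _ _).
have k2 := hN0 N (leq_maxl _ _).
have BW x : truncate A N x -> - N%:Z <= x <= N%:Z.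
  by have [sA _] := SA; move=> [Ax Nx]; have [x0 _] := sA x Ax; lia.
have BE x : truncate A N x -> evenz x by move=> [Ax _]; exact: in_S_even SA x Ax.
have k3 := hn0 n (truncate A N) N n0n BE BW.
rewrite espB esp_cst -(expect_truncate modelX f) // in k3.
have k4 : C * prob p (box (N + n.*2) n) (killed (truncate A N) n) <= e / 3.
  apply: (@le_trans _ _ ((C + 1) * (e / 3 / (C + 1)))).
    apply: ler_pM => //; [exact: le_trans (normr_ge0 _) (fC (fun=> false))|exact: prob_ge0 (ltW p0) (ltW p1) _ _|].
    by rewrite lerDl.
  by rewrite mulrC divfK // gt_eqF.
rewrite distrC -(subrKA (expect_f P X (truncate A N) f n)).
apply: le_trans (ler_normD _ _) _; apply: le_trans (lerD k1 k3) _.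
by lra.
Qed.
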